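(* Let $P$ be a $d$-polytope, and let $\Pi$ be the graph obtained from the vertex-facet incidence graph $\Gamma_P$ by removing the nodes of degree $d$. If $\Pi$ is $3$-degenerate, then $\mathcal{R}_{\mathbf 0}(P)$ is a smooth manifold of dimension $\mathrm{NG}(P)$.
   Context: A $d$-polytope is a $d$-dimensional convex polytope. Polytopes are labeled: the $n=f_0(P)$ vertices and $m=f_{d-1}(P)$ facets are numbered; $f_{0,d-1}(P)$ is the number of vertex-facet incidences. A labeled $d$-polytope $Q\subset\mathbb{R}^d$ realizes $P$ if there is an isomorphism between the face lattices of $P$ and $Q$ respecting the labels of vertices and facets. The centered realization space is $$\mathcal{R}_{\mathbf 0}(P)=\{(V,A)\in\mathbb{R}^{d\times(n+m)} \mid \operatorname{conv}(V)=\{\mathbf x\in\mathbb{R}^d\mid A^t\mathbf x\le\mathbf 1\}\text{ realizes }P\},$$ where $\operatorname{conv}(V)$ is the convex hull of the columns of $V$. ''Smooth manifold'' means smoothly embedded submanifold of $\mathbb{R}^{d\times(n+m)}$. The natural guess is $\mathrm{NG}(P)=d(f_0(P)+f_{d-1}(P))-f_{0,d-1}(P)$. The vertex-facet incidence graph $\Gamma_P$ is the bipartite graph whose nodes are the vertices and the facets of $P$, with an edge between a vertex and a facet iff the vertex lies in the facet. An undirected graph is $k$-degenerate if its nodes can be ordered so that each node has at most $k$ neighbors appearing after it in the ordering. *)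

(* Defs.v *)
From HB Require Import structures.
From mathcomp Require Import all_boot all_order all_algebra.
From mathcomp Require Import all_classical all_reals all_analysis.
Import Order.TTheory GRing.Theory Num.Theory.
Import numFieldNormedType.Exports.

Set Implicit Arguments.
Unset Strict Implicit.
Unset Printing Implicit Defensive.

Local Open Scope classical_set_scope.
Local Open Scope ring_scope.

Section Smooth.
Context {R : realType}.

(* On an open set U of a finite-dimensional space this is the usual notion of
   C^k map: the iterated directional derivatives of order < k are
   differentiable on U, and those of order k are continuous on U. *)
Fixpoint Ck_on {V W : normedModType R} (k : nat) (U : set V) (f : V -> W)
    : Prop :=
  match k with
  | 0 => forall x, U x -> {for x, continuous f}
  | k'.+1 => (forall x, U x -> differentiable f x) /\
             (forall v, Ck_on k' U (fun x => 'D_v f x))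
  end.

Definition smooth_on {V W : normedModType R} (U : set V) (f : V -> W) : Prop :=
  forall k, Ck_on k U f.

Definition diffeomorphism {V W : normedModType R} (U : set V) (U' : set W)
    (f : V -> W) (g : W -> V) : Prop :=
  [/\ open U /\ open U',
      (forall x, U x -> U' (f x) /\ g (f x) = x),
      (forall y, U' y -> U (g y) /\ f (g y) = y),
      smooth_on U f & smooth_on U' g].

(* Smoothly embedded submanifold of dimension k of the space of p x q
   matrices, via slice charts: around each of its points, S is carried by a
   diffeomorphism between open sets onto the vanishing locus of all but the
   first k coordinates. *)
Definition embedded_submanifold {p q : nat} (S : set 'M[R]_(p, q)) (k : nat)
    : Prop :=
  (k <= p * q)%N /\
  forall x, S x ->
    exists (U : set 'M[R]_(p, q)) (U' : set 'rV[R]_(p * q))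
           (f : 'M[R]_(p, q) -> 'rV[R]_(p * q))
           (g : 'rV[R]_(p * q) -> 'M[R]_(p, q)),
      [/\ U x, diffeomorphism U U' f g &
          forall y, U y ->
            (S y <-> forall i : 'I_(p * q), (k <= i)%N -> f y ord0 i = 0)].

End Smooth.

Section Polytopes.
Context {R : realType}.

Definition conv {e k : nat} (M : 'M[R]_(e, k)) : set 'cV[R]_e :=
  [set x | exists l : 'cV[R]_k,
     [/\ forall i, 0 <= l i ord0, \sum_i l i ord0 = 1 & x = M *m l]].

Definition is_polytope {e : nat} (Q : set 'cV[R]_e) : Prop :=
  exists (k : nat) (M : 'M[R]_(e, k)), Q = conv M.

(* The columns of M are affinely independent: homogenize and test linear
   independence. *)
Definition aff_free {e k : nat} (M : 'M[R]_(e, k)) : bool :=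
  \rank (col_mx (const_mx 1 : 'rV[R]_k) M) == k.

(* aff_rank S r: the set S has dimension r - 1. The shift by one lets the
   empty set have dimension -1. *)
Definition aff_rank {e : nat} (S : set 'cV[R]_e) (r : nat) : Prop :=
  (exists M : 'M[R]_(e, r), aff_free M /\ forall i, S (col i M)) /\
  (forall (k : nat) (M : 'M[R]_(e, k)),
     aff_free M -> (forall i, S (col i M)) -> (k <= r)%N).

(* The empty face (c = 0, b = 1) and Q itself (c = 0, b = 0) are included. *)
Definition face {e : nat} (Q F : set 'cV[R]_e) : Prop :=
  exists (c : 'cV[R]_e) (b : R),
    (forall x, Q x -> (c^T *m x) ord0 ord0 <= b) /\
    F = [set x | Q x /\ (c^T *m x) ord0 ord0 = b].

Definition is_vertex {e : nat} (Q : set 'cV[R]_e) (v : 'cV[R]_e) : Prop :=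
  face Q [set v].

(* Facets of a d-polytope: the faces of dimension d - 1. *)
Definition is_facet {e : nat} (d : nat) (Q F : set 'cV[R]_e) : Prop :=
  face Q F /\ aff_rank F d.

Record labeled_body (e n m : nat) := LabeledBody {
  body : set 'cV[R]_e;
  vertex : 'I_n -> 'cV[R]_e;
  facet : 'I_m -> set 'cV[R]_e }.

Definition is_labeled_polytope {e n m : nat} (d : nat)
    (P : labeled_body e n m) : Prop :=
  [/\ is_polytope (body P), aff_rank (body P) d.+1,
      injective (vertex P) /\ range (vertex P) = is_vertex (body P) &
      injective (facet P) /\ range (facet P) = is_facet d (body P)].

Definition face_lattice_iso {e e' n m : nat}
    (P : labeled_body e n m) (Q : labeled_body e' n m) : Prop :=
  exists phi : set 'cV[R]_e -> set 'cV[R]_e',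
    [/\ phi @` face (body P) = face (body Q),
        (forall F G, face (body P) F -> face (body P) G ->
           (phi F `<=` phi G <-> F `<=` G)),
        (forall i, phi [set vertex P i] = [set vertex Q i]) &
        (forall j, phi (facet P j) = facet Q j)].

Definition realizes {e n m d : nat}
    (Q : labeled_body d n m) (P : labeled_body e n m) : Prop :=
  is_labeled_polytope d Q /\ face_lattice_iso P Q.

Definition polyhedron {d m : nat} (A : 'M[R]_(d, m)) : set 'cV[R]_d :=
  [set x | forall j, (A^T *m x) j ord0 <= 1].

(* conv V, with vertices labeled by the columns of V and facets labeled by the
   inequalities given by the columns of A. *)
Definition labeled_conv {d n m : nat} (V : 'M[R]_(d, n)) (A : 'M[R]_(d, m))
    : labeled_body d n m :=
  LabeledBody (conv V) (fun i => col i V)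
    (fun j => [set x | conv V x /\ (A^T *m x) j ord0 = 1]).

Definition centered_realization_space {e n m : nat} (d : nat)
    (P : labeled_body e n m) : set 'M[R]_(d, n + m) :=
  [set VA | conv (lsubmx VA) = polyhedron (rsubmx VA) /\
            realizes (labeled_conv (lsubmx VA) (rsubmx VA)) P].

Definition incident {e n m : nat} (P : labeled_body e n m)
    (i : 'I_n) (j : 'I_m) : bool :=
  `[< facet P j (vertex P i) >].

Definition num_incidences {e n m : nat} (P : labeled_body e n m) : nat :=
  #|[set ij : 'I_n * 'I_m | incident P ij.1 ij.2]%SET|.

Definition natural_guess {e n m : nat} (d : nat) (P : labeled_body e n m)
    : int :=
  (d * (n + m))%:Z - (num_incidences P)%:Z.

Definition incidence_graph {e n m : nat} (P : labeled_body e n m)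
    : rel ('I_n + 'I_m) :=
  fun x y => match x, y with
             | inl i, inr j | inr j, inl i => incident P i j
             | _, _ => false
             end.

End Polytopes.

Arguments centered_realization_space {R e n m} d P _.

Section Graphs.

Definition degree {T : finType} (E : rel T) (x : T) : nat :=
  #|[set y | E x y]%SET|.

Definition degenerate {T : finType} (k : nat) (E : rel T) : Prop :=
  exists s : seq T,
    [/\ uniq s, (forall x, x \in s) &
        forall x,
          (#|[set y | E x y && (index x s < index y s)%N]%SET| <= k)%N].

Definition remove_degree (T : finType) (E : rel T) (d : nat)
    : rel {x : T | degree E x != d} :=
  fun x y => E (val x) (val y).

End Graphs.
Arguments remove_degree {T} E d x y.

(* Main.v *)
Require Import Defs.
From HB Require Import structures.
From mathcomp Require Import all_boot all_order all_algebra.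
From mathcomp Require Import all_classical all_reals all_analysis.
From mathcomp Require Import ring lra.
Import Order.TTheory GRing.Theory Num.Theory.
Import numFieldNormedType.Exports.

(** Near each of its points (V, A), the centered realization space is the set of
    solutions of the equations a_j . v_i = 1, one for each incident pair of a
    vertex v_i and a facet normal a_j; and this system can be solved by back
    substitution.

    That nearby solutions are realizations is [realization_near]. For A close to
    A0, the polyhedron of A lies in a slight dilation of conv V0, so inequalities
    that share no vertex are never tight together; every point of the polyhedron
    can then be moved along segments to points with more tight inequalities, and
    in the end to a vertex ([closed_pair_perturb]). Once conv V is the polyhedron
    of A, its faces are the sets where given inequalities are tight
    ([face_tight]), so the labeled face lattice is determined by the incidences
    ([same_incidences_iso]).

    To solve the system, the nodes of the incidence graph are ordered with those
    of degree d first, followed by the remaining ones in an order that witnesses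
    3-degeneracy. Each equation is assigned to the earlier of its two nodes. Going
    from the last node to the first, the vector of a node is then subject to one
    affine equation for each later neighbour. When the vectors of the later
    neighbours are linearly independent, completing them by constant vectors to a
    basis turns the equations of the node into coordinates: the products of its
    vector with the basis. All these products together form a polynomial map whose
    inverse is rational and defined on an open set, which is the chart wanted
    ([unit_products_chart]). The number of free coordinates is d (n + m) minus the
    number of equations.

    Independence is where the hypothesis enters. The neighbours of a node span the
    space ([neighbours_span]), so those of a node of degree d form a basis. Any
    other node has at most three later neighbours. Three vertices of a facet are
    not collinear and lie on a hyperplane that avoids the origin, so they are
    independent; dually for three facets through a vertex ([exposed_row_free]).
    For four vertices of a facet this fails, since they may be coplanar. *)

Set Implicit Arguments.
Unset Strict Implicit.
Unset Printing Implicit Defensive.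

Local Open Scope classical_set_scope.
Local Open Scope ring_scope.

Local Notation conv := Defs.conv.

(** * Smooth maps *)

Section SmoothCalculus.
Context {R : realType} {V : normedModType R}.

Lemma near_eq_differentiable {W : normedModType R} (f g : V -> W) (x : V) :
  (\near x, f x = g x) -> differentiable f x -> differentiable g x.
Proof.
move=> fg df; have fgx := nbhs_singleton fg.
have [dfc fE] := (diff_locallyP _ _).1 df.
have gE : g \o shift x = cst (g x) + 'd f x +o_ 0 id.
  apply/eqaddoE/eqaddoP => _/posnumP[e].
  have /eqaddoP/(_ e%:num (gt0 _)) := fE.
  move: fg; rewrite (near_shift 0 x) subr0 => fg.
  apply: filterS2 fg => h /= fgh.
  by rewrite /= !fctE /= -fgx -fgh.
apply/diff_locallyP.
have -> : 'd g x = 'd f x :> (V -> W) by exact: diff_unique.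
by split.
Qed.

(** The derivatives at a point of an open set depend only on the values
    nearby. *)
Lemma eq_Ck {W : normedModType R} k (U : set V) (f g : V -> W) : open U ->
  (forall x, U x -> f x = g x) -> Ck_on k U f -> Ck_on k U g.
Proof.
move=> oU; have nearU x : U x -> \near x, U x by move=> Ux; exact: open_nbhs_nbhs.
elim: k f g => [|k IHk] f g fg.
  move=> /= cf x Ux; change (g y @[y --> x] --> g x); rewrite -(fg x Ux).
  apply: cvg_trans (cf x Ux); apply: near_eq_cvg.
  by near=> y; apply: fg; near: y; exact: nearU.
move=> [df Ddf]; split=> [x Ux|v].
  apply: near_eq_differentiable (df x Ux).
  by near=> y; apply: fg; near: y; exact: nearU.
apply: IHk (Ddf v) => x Ux; apply: near_eq_derive.
by near=> y; apply: fg; near: y; exact: nearU.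
Unshelve. all: by end_near. Qed.

Lemma Ck_le {W : normedModType R} k (U : set V) (f : V -> W) :
  Ck_on k.+1 U f -> Ck_on k U f.
Proof.
elim: k f => [|k IHk] f [df Ddf]; last by split=> // v; exact: IHk.
by move=> x Ux; exact/differentiable_continuous/df.
Qed.

Lemma sub_Ck {W : normedModType R} k (U U' : set V) (f : V -> W) :
  U' `<=` U -> Ck_on k U f -> Ck_on k U' f.
Proof.
move=> sU; elim: k f => [|k IHk] f /=; first by move=> cf x /sU /cf.
by move=> [df Ddf]; split=> [x /sU /df //|v]; exact: IHk.
Qed.

Lemma Ck_cst {W : normedModType R} k (U : set V) (a : W) :
  Ck_on k U (fun=> a).
Proof.
elim: k a => [|k IHk] a; first by move=> x _; exact: cvg_cst.
split=> [x _|v]; first exact: differentiable_cst.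
by under eq_fun do rewrite derive_cst; exact: IHk.
Qed.

Lemma Ck_linear {W : normedModType R} k (U : set V) (f : {linear V -> W}) :
  continuous f -> Ck_on k U f.
Proof.
case: k => [|k] cf; first by move=> x _; exact: cf.
have df x : differentiable f x by exact: linear_differentiable.
split=> [x _ //|v].
by under eq_fun do rewrite deriveE // diff_lin //; exact: Ck_cst.
Qed.

Lemma Ck_add {W : normedModType R} k (U : set V) (f g : V -> W) : open U ->
  Ck_on k U f -> Ck_on k U g -> Ck_on k U (fun x => f x + g x).
Proof.
move=> oU; elim: k f g => [|k IHk] f g.
  by move=> cf cg x Ux; apply: cvgD; [exact: cf|exact: cg].
move=> [df Df] [dg Dg]; split=> [x Ux|v].
  by apply: differentiableD; [exact: df|exact: dg].
apply: eq_Ck (IHk _ _ (Df v) (Dg v)) => // x Ux.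
have dfx : derivable f x v by exact/diff_derivable/df.
by rewrite (deriveD dfx) //; exact/diff_derivable/dg.
Qed.

Lemma Ck_mul k (U : set V) (f g : V -> R) : open U ->
  Ck_on k U f -> Ck_on k U g -> Ck_on k U (fun x => f x * g x).
Proof.
move=> oU; elim: k f g => [|k IHk] f g.
  by move=> cf cg x Ux; apply: cvgM; [exact: cf|exact: cg].
move=> Cf Cg; have [df Df] := Cf; have [dg Dg] := Cg; split=> [x Ux|v].
  by apply: differentiableM; [exact: df|exact: dg].
apply: (@eq_Ck _ _ _ (fun x => f x * 'D_v g x + g x * 'D_v f x)) => //.
  move=> x Ux; have dfx : derivable f x v by exact/diff_derivable/df.
  by rewrite (deriveM dfx) //; exact/diff_derivable/dg.
apply: Ck_add => //.
  by apply: IHk; [exact: Ck_le Cf|exact: Dg].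
by apply: IHk; [exact: Ck_le Cg|exact: Df].
Qed.

Lemma Ck_inv k (U : set V) (f : V -> R) : open U ->
  (forall x, U x -> f x != 0) -> Ck_on k U f -> Ck_on k U (fun x => (f x)^-1).
Proof.
move=> oU f0; elim: k => [|k IHk].
  by move=> cf x Ux; apply: cvgV; [exact: f0|exact: cf].
move=> Cf; have [df Df] := Cf; have Cfk := Ck_le Cf; split=> [x Ux|v].
  by apply: differentiableV; [exact: df|exact: f0].
apply: (@eq_Ck _ _ _ (fun x => -1 * ((f x)^-1 * (f x)^-1) * 'D_v f x)) => //.
  move=> x Ux; rewrite deriveV ?f0 //; last exact/diff_derivable/df.
  by rewrite mulN1r expr2 invfM.
apply: Ck_mul => //; last exact: Df.
apply: Ck_mul => //; first exact: Ck_cst.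
by apply: Ck_mul => //; exact: IHk.
Qed.

Lemma Ck_scale {W : normedModType R} k (U : set V) (h : V -> R) (w : W) :
  open U -> Ck_on k U h -> Ck_on k U (fun x => h x *: w).
Proof.
move=> oU; elim: k h => [|k IHk] h.
  by move=> ch x Ux; apply: cvgZr_tmp; exact: ch.
move=> [dh Dh]; split=> [x Ux|v]; first exact: differentiableZl (dh x Ux).
apply: eq_Ck (IHk _ (Dh v)) => // x Ux.
have dhx := dh x Ux; rewrite !deriveE //; last exact: differentiableZl.
by rewrite diffZl.
Qed.

Lemma Ck_sum {W : normedModType R} (I : Type) (r : seq I) (P : pred I)
    k (U : set V) (F : I -> V -> W) : open U ->
  (forall i, P i -> Ck_on k U (F i)) ->
  Ck_on k U (fun x => \sum_(i <- r | P i) F i x).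
Proof.
move=> oU CF; elim: r => [|i r IHr].
  apply: (eq_Ck (f := fun=> (0 : W))) => //; last exact: Ck_cst.
  by move=> x _; rewrite big_nil.
have [Pi|nPi] := boolP (P i); last first.
  by apply: eq_Ck IHr => // x _; rewrite big_cons (negbTE nPi).
apply: (eq_Ck _ _ (Ck_add oU (CF i Pi) IHr)) => // x _.
by rewrite big_cons Pi.
Qed.

Lemma Ck_prod (I : Type) (r : seq I) (P : pred I) k (U : set V)
    (F : I -> V -> R) : open U ->
  (forall i, P i -> Ck_on k U (F i)) ->
  Ck_on k U (fun x => \prod_(i <- r | P i) F i x).
Proof.
move=> oU CF; elim: r => [|i r IHr].
  apply: (eq_Ck (f := fun=> (1 : R))) => //; last exact: Ck_cst.
  by move=> x _; rewrite big_nil.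
have [Pi|nPi] := boolP (P i); last first.
  by apply: eq_Ck IHr => // x _; rewrite big_cons (negbTE nPi).
apply: (eq_Ck _ _ (Ck_mul oU (CF i Pi) IHr)) => // x _.
by rewrite big_cons Pi.
Qed.

(** Smoothness of a matrix valued map is checked entrywise, because the matrix
    is the sum of its entries times constant elementary matrices. *)
Lemma Ck_mx p q k (U : set V) (F : V -> 'M[R]_(p, q)) : open U ->
  (forall i j, Ck_on k U (fun x => F x i j)) -> Ck_on k U F.
Proof.
move=> oU CF.
apply: (eq_Ck (f := fun x => \sum_i \sum_j F x i j *: delta_mx i j)) => //.
  by move=> x _; rewrite -matrix_sum_delta.
by apply: Ck_sum => // i _; apply: Ck_sum => // j _; exact: Ck_scale.
Qed.

Lemma Ck_det p k (U : set V) (F : V -> 'M[R]_p) : open U ->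
  (forall i j, Ck_on k U (fun x => F x i j)) ->
  Ck_on k U (fun x => \det (F x)).
Proof.
move=> oU CF; apply: Ck_sum => // s _.
by apply: Ck_mul => //; [exact: Ck_cst|apply: Ck_prod].
Qed.

(** By Cramer's rule, the entries of the inverse are rational functions of those
    of F. *)
Lemma Ck_invmx p k (U : set V) (F : V -> 'M[R]_p) : open U ->
  (forall x, U x -> \det (F x) != 0) ->
  (forall i j, Ck_on k U (fun x => F x i j)) ->
  forall i j, Ck_on k U (fun x => invmx (F x) i j).
Proof.
move=> oU F0 CF i j.
apply: (@eq_Ck _ _ _ (fun x => (\det (F x))^-1 * \adj (F x) i j)) => //.
  by move=> x Ux; rewrite /invmx unitmxE unitfE F0 // [RHS]mxE.
apply: Ck_mul => //; first by apply: Ck_inv => //; exact: Ck_det.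
apply: (eq_Ck (f := fun x => cofactor (F x) j i : R)) => // [x _|].
  by rewrite mxE.
apply: Ck_mul => //; first exact: Ck_cst.
apply: Ck_det => // a b; apply: eq_Ck (CF _ _) => // x _.
by rewrite !mxE.
Qed.

Lemma Ck_mulmx p q r k (U : set V) (F : V -> 'M[R]_(p, q))
    (G : V -> 'M[R]_(q, r)) : open U ->
  (forall i j, Ck_on k U (fun x => F x i j)) ->
  (forall i j, Ck_on k U (fun x => G x i j)) ->
  forall i j, Ck_on k U (fun x => (F x *m G x) i j).
Proof.
move=> oU CF CG i j.
apply: (eq_Ck (f := fun x => \sum_a F x i a * G x a j : R)) => // [x _|].
  by rewrite mxE.
by apply: Ck_sum => // a _; exact: Ck_mul.
Qed.

End SmoothCalculus.

Lemma Ck_coord (R : realType) p q i j k (U : set 'M[R]_(p, q)) :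
  Ck_on k U (fun y : 'M[R]_(p, q) => y i j : R).
Proof.
have @f : {linear 'M[R]_(p, q) -> R}.
  exists (fun y : 'M[R]_(p, q) => y i j).
  by do 2![eexists]; do ?[constructor]; rewrite ?mxE // => ? *;
     rewrite ?mxE // => ?; rewrite !mxE.
by apply: (@Ck_linear _ _ _ k U f); exact: coord_continuous.
Qed.

Lemma open_setI_preimage (S T : topologicalType) (U : set S) (O : set T)
    (f : S -> T) : open U -> open O ->
  (forall x, U x -> {for x, continuous f}) -> open (U `&` f @^-1` O).
Proof.
move=> oU oO cf; rewrite openE => x [Ux Ofx]; apply: filterI.
  exact: open_nbhs_nbhs.
by apply: cf => //; exact: open_nbhs_nbhs.
Qed.

(** * Charts for systems of unit scalar products *)

(** Extending a free family to a basis: its span has a complement of the right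
    dimension. *)
Lemma complete_row_free (F : fieldType) k d (B : 'M[F]_(k, d)) : row_free B ->
  exists2 D : 'M[F]_d, D \in unitmx &
    forall (a : 'I_k) (b : 'I_d), a = b :> nat -> row b D = row a B.
Proof.
move=> freeB; have rB := eqP freeB.
have kd : (k <= d)%N by rewrite -rB rank_leq_col.
have [l dE] : exists l, d = (k + l)%N by exists (d - k)%N; rewrite subnKC.
subst d; have rC : \rank (B^C)%MS = l by rewrite mxrank_compl rB addKn.
pose C : 'M[F]_(l, k + l) := castmx (rC, erefl) (row_base (B^C)%MS).
exists (col_mx B C) => [|a b ab].
  rewrite -row_full_unit -sub1mx -addsmxE.
  have := addsmx_compl_full B; rewrite -sub1mx => /submx_trans; apply.
  by apply: addsmxS => //; rewrite eqmx_cast eq_row_base.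
have -> : b = lshift l a by apply/val_inj.
by rewrite rowKu.
Qed.

(** Used with P selecting the coordinates that come from equations, which slice
    charts require to be the last ones. *)
Lemma enum_last (T : finType) (n : nat) (P : pred T) : #|T| = n ->
  exists (f : 'I_n -> T) (g : T -> 'I_n), [/\ cancel f g, cancel g f &
    forall k, P (f k) = (n - #|P| <= k)%N].
Proof.
move=> Tn; pose l := [seq x <- enum T | ~~ P x] ++ [seq x <- enum T | P x].
have lE : perm_eq l (enum T) by rewrite /l perm_catC perm_filterC.
have szP : size [seq x <- enum T | P x] = #|P|.
  by rewrite cardE enumT /enum_mem; congr size; apply: eq_filter.
have szl : size l = n by rewrite (perm_size lE) -cardE.
have uniql : uniq l by rewrite (perm_uniq lE) enum_uniq.
have sznP : size [seq x <- enum T | ~~ P x] = (n - #|P|)%N.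
  by rewrite -szl size_cat szP addnK.
have meml x : x \in l by rewrite (perm_mem lE) mem_enum.
have idx x : (index x l < n)%N by rewrite -szl index_mem.
pose f (k : 'I_n) := tnth (in_tuple l) (cast_ord (esym szl) k).
have fE x k : f k = nth x l k by rewrite /f (tnth_nth x).
exists f, (fun x => Ordinal (idx x)); split.
- move=> k; apply/val_inj; rewrite /= (fE (f k)) index_uniq //.
  by rewrite szl.
- by move=> x; rewrite (fE x) /= nth_index.
- move=> k; rewrite (fE (f k)) nth_cat sznP.
  have [lt_k|ge_k] := ltnP k (n - #|P|).
    have : nth (f k) [seq x <- enum T | ~~ P x] k
             \in [seq x <- enum T | ~~ P x] by rewrite mem_nth // sznP.
    by rewrite mem_filter => /andP[/negbTE].
  have : nth (f k) [seq x <- enum T | P x] (k - (n - #|P|))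
           \in [seq x <- enum T | P x].
    rewrite mem_nth // szP ltn_subLR // subnK //.
    by rewrite -Tn max_card.
  by rewrite mem_filter => /andP[].
Qed.

Section Elimination.
Context {R : realType} {d N : nat} (E : rel 'I_N) (s : seq 'I_N).
Implicit Types (y z : 'M[R]_(d, N)) (i j : 'I_N) (t : seq 'I_N).

Definition later i : seq 'I_N :=
  [seq j <- enum 'I_N | E i j && (index i s < index j s)%N].

Definition later_mx i y : 'M[R]_(size (later i), d) :=
  \matrix_(a, b) y b (nth i (later i) a).

Lemma mem_later i j :
  (j \in later i) = E i j && (index i s < index j s)%N.
Proof. by rewrite mem_filter mem_enum andbT. Qed.

(** D i is meant to complete the vectors of the later neighbours of i to a basis:
    its first rows are replaced by these vectors in the frame of i. *)
Variable D : 'I_N -> 'M[R]_d.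

Definition frame_mx i y : 'M[R]_d :=
  \matrix_(a, b) if (a < size (later i))%N then y b (nth i (later i) a)
                 else D i a b.

Definition shift_mx : 'M[R]_(d, N) :=
  \matrix_(a, i) (a < size (later i))%N%:R.

(** The scalar products of the vector of each node with the rows of its frame.
    Those with a later neighbour are shifted, so that they vanish exactly when
    the product is 1. *)
Definition straighten y : 'M[R]_(d, N) :=
  \matrix_(a, i) ((frame_mx i y *m y) a i - shift_mx a i).

Definition solve_node z i y : 'M[R]_(d, N) :=
  \matrix_(b, k) if k == i then (invmx (frame_mx i y) *m (z + shift_mx)) b i
                 else y b k.

(** Back substitution, from the last node of t to the first. *)
Definition solve t z : 'M[R]_(d, N) := foldr (solve_node z) 0 t.

Definition regular t : set 'M[R]_(d, N) :=
  [set y | forall i, i \in t -> \det (frame_mx i y) != 0].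

Local Notation increasing :=
  (pairwise (fun i j => (index i s < index j s)%N)).

Lemma eq_frame_mx i y y' : (forall b j, j \in later i -> y b j = y' b j) ->
  frame_mx i y = frame_mx i y'.
Proof.
move=> eqy; apply/matrixP => a b; rewrite !mxE; case: ifP => // lt_a.
by apply: eqy; exact: mem_nth.
Qed.

Lemma frame_mx_solve_node z i j t y : increasing (i :: t) -> j \in i :: t ->
  frame_mx j (solve_node z i y) = frame_mx j y.
Proof.
rewrite pairwise_cons => /andP[/allP it _] jt; apply: eq_frame_mx => b k.
rewrite mem_later mxE => /andP[_ jk]; have [ki|//] := eqVneq k i.
move: jt jk; rewrite ki inE => /predU1P[->|/it]; first by rewrite ltnn.
by move=> /ltnW; rewrite leqNgt => /negbTE ->.
Qed.

Lemma regular_cons z i t : increasing (i :: t) ->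
  regular (i :: t) (solve (i :: t) z) =
  (regular t (solve t z) /\ \det (frame_mx i (solve t z)) != 0).
Proof.
move=> it; apply/propext; split=> [reg|[reg regi] j jt] /=.
  split=> [j jt|].
    have jit : j \in i :: t by rewrite inE jt orbT.
    by rewrite -(frame_mx_solve_node z _ it jit); exact: reg.
  have iit : i \in i :: t by rewrite inE eqxx.
  by rewrite -(frame_mx_solve_node z _ it iit); exact: reg.
rewrite (frame_mx_solve_node _ _ it) //.
by move: jt; rewrite inE => /predU1P[->//|]; exact: reg.
Qed.

Lemma solveP t z : uniq t -> increasing t -> regular t (solve t z) ->
  forall a i, i \in t -> straighten (solve t z) a i = z a i.
Proof.
elim: t => // i t IHt /andP[nit ut] it; rewrite regular_cons //.
have it' : increasing t by move: it; rewrite pairwise_cons => /andP[].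
move=> [reg regi] a j jt; rewrite !mxE.
under eq_bigr do rewrite /= (frame_mx_solve_node _ _ it) // [solve_node _ _ _ _ _]mxE.
have [ji|ji] := eqVneq j i; last first.
  rewrite inE (negbTE ji) /= in jt.
  by rewrite -(IHt ut it' reg a j jt) !mxE.
rewrite ji; set F := frame_mx i _; set B := invmx F *m _.
have -> : \sum_k F a k * B k i = (F *m B) a i by rewrite mxE.
rewrite /B mulKVmx ?unitmxE ?unitfE //.
by rewrite !mxE addrK.
Qed.

(** As t is closed under later neighbours, the frames used in the substitution
    are those of y. *)
Lemma solve_straighten t y : increasing t -> regular t y ->
  (forall i, i \in t -> {subset later i <= t}) ->
  forall b i, i \in t -> solve t (straighten y) b i = y b i.
Proof.
elim: t => // i t IHt it reg cl b j jt; rewrite /= mxE.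
have it' : increasing t by move: it; rewrite pairwise_cons => /andP[].
have cl' k : k \in i :: t -> {subset later k <= t}.
  move=> kt l lk; have := cl k kt l lk; rewrite inE => /predU1P[li|//].
  move: lk it; rewrite mem_later pairwise_cons li => /andP[_ ki] /andP[/allP it _].
  move: kt; rewrite inE => /predU1P[ki'|/it]; first by rewrite ki' ltnn in ki.
  by move=> /ltnW; rewrite leqNgt ki.
have IH c k : k \in t -> solve t (straighten y) c k = y c k.
  apply: IHt => // [l lt|l lt]; first by apply: reg; rewrite inE lt orbT.
  by apply: cl'; rewrite inE lt orbT.
have [ji|ji] := eqVneq j i; last first.
  by apply: IH; rewrite inE (negbTE ji) in jt.
rewrite ji (@eq_frame_mx i _ y) => [|c k kl]; last first.
  by apply: IH; apply: (cl' i) => //; rewrite inE eqxx.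
have -> : (invmx (frame_mx i y) *m (straighten y + shift_mx)) b i =
          (invmx (frame_mx i y) *m (frame_mx i y *m y)) b i.
  rewrite [LHS]mxE [RHS]mxE; apply: eq_bigr => a _; congr (_ * _).
  by rewrite !mxE subrK.
by rewrite mulKmx // unitmxE unitfE reg // inE eqxx.
Qed.

(** Nodes are processed from the last one on, so that the frame of a node is
    already a smooth function of the parameters when its vector is solved
    for. *)
Lemma smooth_solve {V : normedModType R} (Z : V -> 'M[R]_(d, N)) t :
  (forall k a i, Ck_on k [set: V] (fun v => Z v a i)) -> increasing t ->
  open [set v | regular t (solve t (Z v))] /\
  forall k a i,
    Ck_on k [set v | regular t (solve t (Z v))] (fun v => solve t (Z v) a i).
Proof.
move=> CZ; elim: t => [_|i t IHt it].
  have -> : [set v | regular [::] (solve [::] (Z v))] = setT.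
    by apply/seteqP; split.
  split; first exact: openT.
  by move=> k a j; under eq_fun do rewrite mxE; exact: Ck_cst.
have /IHt[oW CW] : increasing t by move: it; rewrite pairwise_cons => /andP[].
set W := [set v | regular t _] in oW CW.
pose F v := frame_mx i (solve t (Z v)).
have -> : [set v | regular (i :: t) (solve (i :: t) (Z v))] =
          W `&` (fun v => \det (F v)) @^-1` [set x : R | x != 0].
  by apply/seteqP; split=> v /=; rewrite regular_cons.
have CF k a b : Ck_on k W (fun v => F v a b).
  have [lt_a|ge_a] := ltnP a (size (later i)).
    by apply: eq_Ck (CW k b (nth i (later i) a)) => // v _; rewrite mxE lt_a.
  apply: (eq_Ck (f := fun=> D i a b)) => // [v _|]; last exact: Ck_cst.
  by rewrite mxE ltnNge ge_a.
have oWi : open (W `&` (fun v => \det (F v)) @^-1` [set x : R | x != 0]).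
  apply: open_setI_preimage => //.
  exact: (@Ck_det _ _ _ 0 W F oW (CF 0)).
split=> // k a j /=.
set W' := W `&` _ in oWi *.
have sW (f : V -> R) : Ck_on k W f -> Ck_on k W' f.
  by apply: sub_Ck; exact: subIsetl.
have [ji|ji] := eqVneq j i; last first.
  by apply: eq_Ck (sW _ (CW k a j)) => // v _; rewrite [RHS]mxE (negbTE ji).
apply: (eq_Ck (f := fun v => (invmx (F v) *m (Z v + shift_mx)) a i)) => //.
  by move=> v _; rewrite [RHS]mxE ji eqxx.
apply: Ck_mulmx => // [b c|b c].
  apply: Ck_invmx => // [v []//|b' c']; exact: sW.
apply: (eq_Ck (f := fun v => Z v b c + shift_mx b c)) => // [v _|].
  by rewrite [RHS]mxE.
by apply: Ck_add => //; [exact: sub_Ck (CZ k b c)|exact: Ck_cst].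
Qed.

End Elimination.

Lemma index_pairwise (T : eqType) (s : seq T) : uniq s ->
  pairwise (fun x y => (index x s < index y s)%N) s.
Proof.
move=> us; case: s us => // x0 s us; apply/(pairwiseP x0) => i j ij ? ?.
by rewrite !index_uniq.
Qed.

Section Chart.
Context {R : realType} {d N : nat} (E : rel 'I_N) (s : seq 'I_N).
Hypotheses (Esym : symmetric E) (Eirr : irreflexive E).
Hypotheses (us : uniq s) (ins : forall i, i \in s).
Implicit Types (y z : 'M[R]_(d, N)).

Local Notation later := (later E s).

Definition unit_products y :=
  forall i j, E i j -> \sum_b y b i * y b j = 1.

(** Every edge gives an equation at the endpoint that comes first. *)
Lemma straighten_eq0 (D : 'I_N -> 'M[R]_d) y :
  (forall i, size (later i) <= d)%N ->
  unit_products y <->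
  forall (a : 'I_d) i, (a < size (later i))%N -> straighten E s D y a i = 0.
Proof.
move=> led; have dotE (a : 'I_d) i : (a < size (later i))%N ->
    straighten E s D y a i =
    \sum_b y b (nth i (later i) a) * y b i - 1.
  by move=> lt_a; rewrite !mxE lt_a; under eq_bigr do rewrite mxE lt_a.
split=> [eqy a i lt_a|eqy].
  apply/eqP; rewrite dotE // subr_eq0; apply/eqP/eqy.
  by have := mem_nth i lt_a; rewrite mem_later Esym => /andP[].
have dot_later i j : j \in later i -> \sum_b y b j * y b i = 1.
  move=> jl; have lt_a : (index j (later i) < size (later i))%N.
    by rewrite index_mem.
  have := eqy (Ordinal (leq_trans lt_a (led i))) i lt_a.
  by rewrite dotE //= nth_index // => /subr0_eq.
move=> i j ij; have [ltij|ltji|eqij] := ltngtP (index i s) (index j s).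
- under eq_bigr do rewrite mulrC.
  by apply: dot_later; rewrite mem_later ij.
- by apply: dot_later; rewrite mem_later Esym ij.
- by move: ij; rewrite (index_inj i (ins i) (ins j) eqij) Eirr.
Qed.

(** With linearly independent later neighbours, all frames are invertible at y0.
    Straightening is polynomial, and back substitution, its inverse, is
    rational. *)
Lemma unit_products_chart (y0 : 'M[R]_(d, N)) (O S : set 'M[R]_(d, N)) :
  open O -> O y0 -> (forall y, O y -> (S y <-> unit_products y)) ->
  (forall i, row_free (later_mx E s i y0)) ->
  exists (U : set 'M[R]_(d, N)) (U' : set 'rV[R]_(d * N))
         (f : 'M[R]_(d, N) -> 'rV[R]_(d * N))
         (g : 'rV[R]_(d * N) -> 'M[R]_(d, N)),
    [/\ U y0, diffeomorphism U U' f g &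
        forall y, U y -> (S y <-> forall k : 'I_(d * N),
          (d * N - \sum_i size (later i) <= k)%N -> f y ord0 k = 0)].
Proof.
move=> oO Oy0 SO freey0.
have led i : (size (later i) <= d)%N.
  by have := freey0 i; rewrite /row_free => /eqP <-; exact: rank_leq_col.
have /choice[D DP] i : exists D : 'M[R]_d, D \in unitmx /\
    forall (a : 'I_(size (later i))) (b : 'I_d), a = b :> nat ->
      row b D = row a (later_mx E s i y0).
  by have [D] := complete_row_free (freey0 i); exists D.
have frame0 i : frame_mx E s D i y0 = D i.
  apply/matrixP => a b; rewrite mxE; case: ifP => // lt_a.
  have /rowP/(_ b) := (DP i).2 (Ordinal lt_a) a erefl.
  by rewrite !mxE.
pose eqn (p : 'I_d * 'I_N) := (p.1 < size (later p.2))%N.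
have card_eqn : #|eqn| = \sum_i size (later i).
  rewrite -sum1_card (eq_bigl (fun p => true && eqn p)) //.
  rewrite -(pair_big_dep xpredT (fun a i => eqn (a, i)) (fun _ _ => 1%N)) /=.
  rewrite (exchange_big_dep xpredT) //=; apply: eq_bigr => i _.
  by rewrite (big_ord_narrow (led i)) sum1_card card_ord.
have [c [c' [cK c'K cE]]] : exists (c : 'I_(d * N) -> 'I_d * 'I_N) c',
    [/\ cancel c c', cancel c' c &
        forall k, eqn (c k) = (d * N - #|eqn| <= k)%N].
  by apply: enum_last; rewrite card_prod !card_ord.
pose Z (v : 'rV[R]_(d * N)) : 'M[R]_(d, N) := \matrix_(a, i) v ord0 (c' (a, i)).
pose f y : 'rV[R]_(d * N) :=
  \row_k straighten E s D y (c k).1 (c k).2.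
have ZfK y : Z (f y) = straighten E s D y.
  by apply/matrixP => a i; rewrite mxE mxE c'K.
pose g v := solve E s D s (Z v).
pose U := O `&` regular E s D s.
pose U' := [set v | regular E s D s (g v)] `&` g @^-1` O.
have incr := index_pairwise us.
have gfK y : U y -> g (f y) = y.
  move=> [Oy regy]; apply/matrixP => b i; rewrite /g ZfK.
  by apply: solve_straighten => // j _ k _; exact: ins.
have CZ k a i : Ck_on k setT (fun v => Z v a i).
  apply: (eq_Ck (f := fun v : 'rV_(d * N) => v ord0 (c' (a, i)) : R)).
  - exact: openT.
  - by move=> v _; rewrite mxE.
  - exact: Ck_coord.
have [oW Cg] := @smooth_solve _ _ _ E s D _ Z s CZ incr.
have Cgmx k : Ck_on k [set v | regular E s D s (g v)] g.
  exact: Ck_mx.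
have oU' : open U' by apply: open_setI_preimage => //; exact: (Cgmx 0).
have Cframe k i a b : Ck_on k setT (fun y => frame_mx E s D i y a b).
  have [lt_a|ge_a] := ltnP a (size (later i)).
    apply: (eq_Ck (f := fun y => y b (nth i (later i) a) : R)) => //.
      exact: openT.
    by move=> y _; rewrite mxE lt_a.
    exact: Ck_coord.
  apply: (eq_Ck (f := fun=> D i a b)) => // [|y _|]; last exact: Ck_cst.
    exact: openT.
  by rewrite mxE ltnNge ge_a.
have oU : open U.
  pose p y := \prod_i \det (frame_mx E s D i y).
  rewrite (_ : U = O `&` p @^-1` [set x : R | x != 0]).
    apply: open_setI_preimage => // y _.
    apply: (@Ck_prod _ _ _ _ _ 0 setT) => // [|i _]; first exact: openT.
    by apply: Ck_det => //; exact: openT.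
  apply/seteqP; split=> y [Oy regy]; split=> //.
    by apply/prodf_neq0 => i _; exact: regy.
  by have /prodf_neq0 regy' : p y != 0 := regy; move=> i _; exact: regy'.
exists U, U', f, g; split.
- by split=> // i _; rewrite frame0 -unitfE -unitmxE; have [] := DP i.
- split=> //.
  + move=> y Uy; have gfy := gfK y Uy; split=> //.
    by rewrite /U' /preimage /= gfy; case: Uy.
  + move=> v [regv Ov]; split=> //; apply/rowP => k; rewrite mxE.
    by rewrite solveP // mxE -surjective_pairing cK.
  + move=> k; apply: sub_Ck (@subsetT _ U) _; apply: Ck_mx; first exact: openT.
    move=> o i; rewrite (ord1 o).
    pose a := (c i).1; pose j := (c i).2.
    apply: (eq_Ck (f := fun y =>
      (frame_mx E s D j y *m y) a j + - shift_mx E s a j)) => //.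
    * exact: openT.
    * by move=> y _; rewrite !mxE.
    * apply: Ck_add; [exact: openT| |exact: Ck_cst].
      apply: Ck_mulmx; [exact: openT|exact: Cframe|].
      by move=> *; exact: Ck_coord.
  + by move=> k; apply: sub_Ck (Cgmx k); exact: subIsetl.
- move=> y [Oy _]; apply: (iff_trans (SO y Oy)).
  apply: (iff_trans (straighten_eq0 D y led)); split=> [eqy k|eqy a i lt_a].
    by rewrite -card_eqn -cE mxE => /eqy.
  have := eqy (c' (a, i)); rewrite mxE c'K; apply.
  by rewrite -card_eqn -cE c'K.
Qed.

End Chart.

(** * Faces of polytopes given by points and by inequalities *)

Section FiniteSums.
Context {R : realType}.

(** One step size that respects finitely many strict inequalities. *)
Lemma exists_small (I : finType) (P : pred I) (p q : I -> R) :
  (forall i, P i -> 0 < p i) ->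
  exists2 eps : R, 0 < eps & forall i, P i -> eps * q i < p i.
Proof.
move=> p0; pose S := \sum_(i | P i) `|q i| / p i.
have S0 : 0 <= S by apply: sumr_ge0 => i Pi; rewrite divr_ge0 // ltW ?p0.
have S1 : 0 < S + 1 by rewrite ltr_wpDl.
exists (S + 1)^-1; first by rewrite invr_gt0.
move=> i Pi; rewrite mulrC ltr_pdivrMr //.
apply: (le_lt_trans (ler_norm _)); rewrite mulrC -ltr_pdivrMr ?p0 //.
rewrite ltr_pwDr // /S (bigD1 i) //= lerDl sumr_ge0 // => k /andP[Pk _].
by rewrite divr_ge0 // ltW ?p0.
Qed.

Lemma sum_eq_bound (I : finType) (P : pred I) (f : I -> R) :
  (forall i, P i -> f i <= 1) -> \sum_(i | P i) f i = #|P|%:R ->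
  forall i, P i -> f i = 1.
Proof.
move=> f1 fE; have /eqP : \sum_(i | P i) (1 - f i) = 0.
  by rewrite sumrB fE sumr_const subrr.
rewrite psumr_eq0 => [/allP f0 i Pi|i Pi]; last by rewrite subr_ge0 f1.
by have := f0 i (mem_index_enum i); rewrite Pi subr_eq0 => /eqP.
Qed.

Lemma sum_le_card (I : finType) (P : pred I) (f : I -> R) :
  (forall i, P i -> f i <= 1) -> \sum_(i | P i) f i <= #|P|%:R.
Proof. by move=> f1; rewrite -sumr_const; apply: ler_sum => i; exact: f1. Qed.

Lemma sum_lt_card (I : finType) (P : pred I) (f : I -> R) i :
  (forall i, P i -> f i <= 1) -> P i -> f i != 1 ->
  \sum_(i | P i) f i < #|P|%:R.
Proof.
move=> f1 Pi fi; rewrite lt_neqAle sum_le_card // andbT.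
by apply: contraNneq fi => /sum_eq_bound ->.
Qed.

End FiniteSums.

Section ConvexHull.
Context {R : realType} {d n : nat}.
Implicit Types (V : 'M[R]_(d, n)) (x y : 'cV[R]_d) (l : 'cV[R]_n).

Lemma mulmx_col p (B : 'M[R]_(p, d)) V i j :
  (B *m col i V) j ord0 = (B *m V) j i.
Proof. by rewrite !mxE; apply: eq_bigr => k _; rewrite mxE. Qed.

Lemma mulmx_comb p (B : 'M[R]_(p, d)) V l j :
  (B *m (V *m l)) j ord0 = \sum_i l i ord0 * (B *m V) j i.
Proof. by rewrite mulmxA mxE; apply: eq_bigr => i _; rewrite mulrC. Qed.

Lemma conv_col V i : conv V (col i V).
Proof.
exists (delta_mx i ord0); split=> [k||]; last by rewrite colE.
  by rewrite mxE andbT ler0n.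
rewrite (bigD1 i) //= mxE !eqxx big1 ?addr0 // => k /negbTE ki.
by rewrite mxE ki.
Qed.

Lemma conv_le p (B : 'M[R]_(p, d)) V j b x :
  (forall i, (B *m V) j i <= b) -> conv V x -> (B *m x) j ord0 <= b.
Proof.
move=> leb [l [l0 l1 ->]]; rewrite mulmx_comb -[leRHS]mul1r -l1 mulr_suml.
by apply: ler_sum => i _; rewrite ler_wpM2l.
Qed.

Lemma sum_rows_mulmx p (B : 'M[R]_(p, d)) q (M : 'M[R]_(d, q))
    (J : {set 'I_p}) k :
  ((\sum_(j in J) row j B) *m M) ord0 k = \sum_(j in J) (B *m M) j k.
Proof.
by rewrite mulmx_suml summxE; apply: eq_bigr => j _; rewrite -row_mul mxE.
Qed.

(** A convex combination of numbers at most b equals b only if those with a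
    nonzero weight do. *)
Lemma conv_tight p (B : 'M[R]_(p, d)) V j b l :
  (forall i, (B *m V) j i <= b) -> (forall i, 0 <= l i ord0) ->
  \sum_i l i ord0 = 1 -> (B *m (V *m l)) j ord0 = b ->
  forall i, l i ord0 != 0 -> (B *m V) j i = b.
Proof.
move=> leb l0 l1 lE i li.
have /eqP : \sum_i l i ord0 * (b - (B *m V) j i) = 0.
  under eq_bigr do rewrite mulrBr.
  by rewrite sumrB -mulr_suml l1 mul1r -mulmx_comb lE subrr.
rewrite psumr_eq0 => [/allP /(_ i (mem_index_enum i))|k _] /=.
  by rewrite mulf_eq0 (negbTE li) subr_eq0 => /eqP.
by rewrite mulr_ge0 // subr_ge0.
Qed.

Lemma weight_neq0 l : \sum_i l i ord0 = 1 -> exists i, l i ord0 != 0.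
Proof.
apply: contra_eqP => /forallNP l0.
rewrite big1 => [|i _]; first by rewrite eq_sym oner_eq0.
by apply/eqP; have := l0 i; case: eqP.
Qed.

Lemma conv_lt p (B : 'M[R]_(p, d)) V j b x :
  (forall i, (B *m V) j i < b) -> conv V x -> (B *m x) j ord0 < b.
Proof.
move=> ltb Vx; have leb i : (B *m V) j i <= b by exact/ltW/ltb.
rewrite lt_neqAle (conv_le leb Vx) andbT; apply/eqP => xb.
have [l [l0 l1 xE]] := Vx; have [i li] := weight_neq0 l1.
rewrite xE in xb; have := ltb i.
by rewrite (conv_tight leb l0 l1 xb li) ltxx.
Qed.

Lemma conv_convex V x y t : 0 <= t -> t <= 1 -> conv V x -> conv V y ->
  conv V (t *: x + (1 - t) *: y).
Proof.
move=> t0 t1 [l [l0 l1 ->]] [k [k0 k1 ->]].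
exists (t *: l + (1 - t) *: k); split=> [i||].
- by rewrite !mxE addr_ge0 // mulr_ge0 // subr_ge0.
- under eq_bigr do rewrite !mxE.
  by rewrite big_split /= -!mulr_sumr l1 k1 !mulr1 addrC subrK.
- by rewrite mulmxDr -!scalemxAr.
Qed.

Lemma conv_bounded V : exists C : R, forall x b, conv V x -> `|x b ord0| <= C.
Proof.
exists (\sum_i \sum_b `|V b i|) => _ b [l [l0 l1 ->]].
rewrite mxE (le_trans (ler_norm_sum _ _ _)) //; apply: ler_sum => i _.
rewrite normrM (bigD1 b) //= -[leLHS]addr0 lerD //; last exact: sumr_ge0.
rewrite ler_piMr // ger0_norm //.
by rewrite -l1 (bigD1 i) //= lerDl sumr_ge0.
Qed.

(** A relative interior point of a face, when I is the set of its generators. *)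
Definition barycenter V (I : {set 'I_n}) : 'cV[R]_d :=
  V *m \col_i (if i \in I then #|I|%:R^-1 else 0).

Lemma mulmx_barycenter p (B : 'M[R]_(p, d)) V (I : {set 'I_n}) j :
  (B *m barycenter V I) j ord0 = #|I|%:R^-1 * \sum_(i in I) (B *m V) j i.
Proof.
rewrite mulmx_comb mulr_sumr [RHS]big_mkcond; apply: eq_bigr => i _ /=.
by rewrite mxE; case: ifP; rewrite ?mul0r.
Qed.

End ConvexHull.

Section Tight.
Context {R : realType} {d n m : nat}.
Implicit Types (V : 'M[R]_(d, n)) (A : 'M[R]_(d, m)) (J K : {set 'I_m}).

Definition active V A i : {set 'I_m} := [set j | (A^T *m V) j i == 1]%SET.

Definition tight V A J : set 'cV[R]_d :=
  [set x | conv V x /\ forall j, j \in J -> (A^T *m x) j ord0 = 1].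

Lemma tight_col V A J i : tight V A J (col i V) <-> J \subset active V A i.
Proof.
split=> [[_ iJ]|/fintype.subsetP iJ].
  by apply/fintype.subsetP => j /iJ; rewrite inE mulmx_col => ->.
by split=> [|j /iJ]; [exact: conv_col|rewrite inE mulmx_col => /eqP].
Qed.

Lemma facet_tight V A j : facet (labeled_conv V A) j = tight V A [set j]%SET.
Proof.
apply/seteqP; split=> x [Vx xj]; split=> //; last by apply: xj; rewrite inE.
by move=> k; rewrite inE => /eqP ->.
Qed.

Variables (V : 'M[R]_(d, n)) (A : 'M[R]_(d, m)).
Hypothesis valid : forall i j, (A^T *m V) j i <= 1.

Lemma tight_support J (l : 'cV[R]_n) : (forall i, 0 <= l i ord0) ->
  \sum_i l i ord0 = 1 -> tight V A J (V *m l) ->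
  forall i, l i ord0 != 0 -> J \subset active V A i.
Proof.
move=> l0 l1 [_ lJ] i li; apply/fintype.subsetP => j /lJ lj; rewrite inE; apply/eqP.
exact: conv_tight lj i li.
Qed.

(** A point of a tight set combines generators in that set, so only the
    generators matter. *)
Lemma tight_subset J K : tight V A J `<=` tight V A K <->
  (forall i, J \subset active V A i -> K \subset active V A i).
Proof.
split=> [JK i /tight_col/JK/tight_col //|JK x Jx].
have [Vx _] := Jx; split=> // j jK; have [l [l0 l1 xE]] := Vx.
rewrite xE mulmx_comb -[RHS]l1; apply: eq_bigr => i _.
have [->|li] := eqVneq (l i ord0) 0; first by rewrite mul0r.
rewrite xE in Jx.
have /fintype.subsetP/(_ j jK) := JK i (tight_support l0 l1 Jx li).
by rewrite inE => /eqP ->; rewrite mulr1.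
Qed.

(** The sum of the inequalities in J supports conv V exactly where all of them
    are tight. *)
Lemma tight_face J : face (conv V) (tight V A J).
Proof.
pose c : 'cV[R]_d := (\sum_(j in J) row j A^T)^T; exists c, #|J|%:R.
have cE x : (c^T *m x) ord0 ord0 = \sum_(j in J) (A^T *m x) j ord0.
  by rewrite trmxK sum_rows_mulmx.
have le1 x j : conv V x -> (A^T *m x) j ord0 <= 1.
  by apply: conv_le => i; exact: valid.
split=> [x Vx|]; first by rewrite cE; apply: sum_le_card => j _; exact: le1.
apply/seteqP; split=> x [Vx xJ]; split=> //; rewrite ?cE.
  by rewrite (eq_bigr (fun=> 1)) ?sumr_const // => j /xJ.
move=> j jJ; move: xJ; rewrite cE => /sum_eq_bound -> // k _; exact: le1.
Qed.

Hypothesis closed_pair : conv V = polyhedron A.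

(** A face contains, with one point, everything tight for the inequalities that
    are tight on the face: from the barycenter of its generators one can move
    slightly away from any such point without leaving the polyhedron. *)
Lemma face_tight F : face (conv V) F -> F !=set0 ->
  exists J, F = tight V A J.
Proof.
move=> [c [b [cb FE]]] [x0]; rewrite FE => -[[l [l0 l1 x0E]] cx0].
have cV i : (c^T *m V) ord0 i <= b.
  by rewrite -mulmx_col; apply: cb; exact: conv_col.
pose I := [set i | (c^T *m V) ord0 i == b]%SET.
have suppI := conv_tight cV.
have [i iI] : exists i, i \in I.
  have [i li] := weight_neq0 l1; exists i; rewrite inE; apply/eqP; apply: suppI li => //.
  by rewrite -x0E.
have I0 : #|I|%:R != 0 :> R.
  by rewrite pnatr_eq0 -lt0n; apply/card_gt0P; exists i.
have I1 : 0 < #|I|%:R^-1 :> R by rewrite invr_gt0 lt_neqAle eq_sym I0 ler0n.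
pose y := barycenter V I.
have cy : (c^T *m y) ord0 ord0 = b.
  rewrite mulmx_barycenter (eq_bigr (fun=> b)) => [|k]; last by rewrite inE => /eqP.
  by rewrite sumr_const -[b *+ _]mulr_natl mulKf.
exists [set j | [forall i in I, j \in active V A i]]%SET.
apply/seteqP; split=> x [Vx xP]; (split; first exact: Vx).
  move=> j; rewrite inE => /forall_inP Ij; have [k [k0 k1 xE]] := Vx.
  rewrite xE mulmx_comb -[RHS]k1; apply: eq_bigr => a _.
  have [->|ka] := eqVneq (k a ord0) 0; first by rewrite mul0r.
  have /Ij : a \in I.
    by rewrite inE; apply/eqP; apply: (suppI _ k0 k1) ka; rewrite -xE.
  by rewrite inE => /eqP ->; rewrite mulr1.
have yJ j : j \notin [set j | [forall i in I, j \in active V A i]]%SET ->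
    0 < 1 - (A^T *m y) j ord0.
  rewrite inE => /forall_inPn[a aI aj].
  rewrite subr_gt0 mulmx_barycenter -[ltRHS](mulVf I0) ltr_pM2l //.
  by apply: (sum_lt_card (i := a)) => //; move: aj; rewrite inE.
have [eps eps0 epsP] := exists_small
  (fun j => (A^T *m (y - x)) j ord0) yJ.
(* The step away from x makes the inequality defining F fail unless it is tight
   at x. *)
have Vz : conv V (y + eps *: (y - x)).
  rewrite closed_pair => j.
  rewrite mulmxDr mxE -scalemxAr [X in _ + X]mxE.
  have [jJ|/epsP] := boolP (j \in [set j | [forall i in I, j \in active V A i]]%SET).
    rewrite mulmxBr [X in _ * X]mxE [X in _ * (_ + X)]mxE (xP j jJ).
    have -> : (A^T *m y) j ord0 = 1.
      rewrite mulmx_barycenter (eq_bigr (fun=> 1)) ?sumr_const ?mulVf //.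
      by move=> a aI; move: jJ; rewrite inE => /forall_inP/(_ a aI); rewrite inE => /eqP.
    by rewrite subrr mulr0 addr0.
  by rewrite ltrBrDl => /ltW.
have := cb _ Vz; rewrite mulmxDr mxE cy -scalemxAr [X in _ + X]mxE.
rewrite mulmxBr [X in _ * X]mxE [X in _ * (_ + X)]mxE cy gerDl pmulr_rle0 // subr_le0.
by move=> le_b; apply/eqP; rewrite eq_le cb.
Qed.

End Tight.

(** * Polytopes with prescribed incidences *)

(** On a hyperplane that avoids the origin, affine independence is linear
    independence. *)
Lemma rank_homogenize_hyperplane (R : realType) d k (M : 'M[R]_(d, k))
    (c : 'rV[R]_d) :
  c *m M = const_mx 1 -> \rank (col_mx (const_mx 1 : 'rV[R]_k) M) = \rank M.
Proof.
move=> cM; apply/eqP; rewrite eqn_leq; apply/andP; split; last first.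
  by apply: mxrankS; rewrite -addsmxE addsmxSr.
by rewrite -cM -{2}[M]mul1mx -mul_col_mx mxrankM_maxr.
Qed.

Section Irredundant.
Context {R : realType} {d n m : nat}.
Implicit Types (V : 'M[R]_(d, n)) (A : 'M[R]_(d, m)) (J K : {set 'I_m}).

Lemma closed_pair_valid V A : conv V = polyhedron A ->
  forall i j, (A^T *m V) j i <= 1.
Proof.
move=> VA i j; have : conv V (col i V) by exact: conv_col.
by rewrite VA => /(_ j); rewrite mulmx_col.
Qed.

(** The polyhedron contains the half-line from the origin in the direction u. *)
Lemma recession0 A (C : R) :
  (forall x b, polyhedron A x -> `|x b ord0| <= C) ->
  forall u : 'cV[R]_d, (forall j, (A^T *m u) j ord0 <= 0) -> u = 0.
Proof.
move=> leC u u0; apply/matrixP => b o; rewrite (ord1 o) mxE.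
apply/eqP; apply/negPn/negP => ub; have ub0 : 0 < `|u b ord0| by rewrite normr_gt0.
have C0 : 0 <= C.
  by apply: le_trans (leC 0 b _) => // j; rewrite mulmx0 mxE ler01.
pose t := (C + 1) / `|u b ord0|.
have t0 : 0 <= t by rewrite divr_ge0 // addr_ge0.
have Ptu : polyhedron A (t *: u).
  by move=> j; rewrite -scalemxAr mxE (le_trans _ ler01) // mulr_ge0_le0.
by have := leC _ b Ptu; rewrite mxE normrM ger0_norm // divfK ?gt_eqF // gerDl ler10.
Qed.

(** What being a polytope with vertices V and facets A means for the incidences
    of V and A. The first three conditions depend on the incidences only, and
    the last one is open, so that the conjunction survives perturbations that
    keep the incidences. The third condition makes the empty face a tight set. *)
Definition irredundant V A : Prop :=
  [/\ forall i k, active V A i \subset active V A k -> i = k,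
      forall j k, (forall i, j \in active V A i -> k \in active V A i) -> j = k,
      forall i, exists j, j \notin active V A i &
      forall j, exists f : 'I_d -> 'I_n,
        (forall a, j \in active V A (f a)) /\ colsub f V \in unitmx].

Lemma tight_setT V A : (forall i j, (A^T *m V) j i <= 1) ->
  (forall i, exists j, j \notin active V A i) ->
  tight V A [set: 'I_m]%SET = set0.
Proof.
move=> valid noall; apply/seteqP; split=> x // Tx.
have [[l [l0 l1 xE]] _] := Tx; rewrite xE in Tx.
have [i /(tight_support valid l0 l1 Tx)/fintype.subsetP all_i] := weight_neq0 l1.
by have [j /negP] := noall i; apply; apply: all_i; rewrite inE.
Qed.

Lemma face_tightE V A F : conv V = polyhedron A -> irredundant V A ->
  face (conv V) F -> exists J, F = tight V A J.
Proof.
move=> VA [_ _ noall _] faceF; have valid := closed_pair_valid VA.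
have [->|F0] := eqVneq F set0; first by exists [set: 'I_m]%SET; rewrite tight_setT.
by apply: face_tight => //; exact/set0P.
Qed.

(** The generators in this tight set lie on all inequalities tight at the column
    i, so by irredundance there is no other. *)
Lemma tight_active V A i : (forall i j, (A^T *m V) j i <= 1) ->
  (forall i k, active V A i \subset active V A k -> i = k) ->
  tight V A (active V A i) = [set col i V].
Proof.
move=> valid irr; apply/seteqP; split=> x; last by move=> ->; apply/tight_col.
move=> Tx; have [[l [l0 l1 xE]] _] := Tx; rewrite xE in Tx *.
have suppi k : k != i -> l k ord0 = 0.
  move=> ki; apply/eqP; apply: contraNT ki => lk.
  by apply/eqP/esym/irr; exact: (tight_support valid l0 l1 Tx).
suff -> : l = delta_mx i ord0 by rewrite -colE.
apply/matrixP => k o; rewrite (ord1 o) mxE eqxx andbT.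
have [->|/suppi //] := eqVneq k i.
by rewrite -l1 (bigD1 i) //= big1 ?addr0 // => k'; exact: suppi.
Qed.

Lemma tight_row V A J j k (M : 'M[R]_(d, k)) : j \in J ->
  (forall b, tight V A J (col b M)) -> row j A^T *m M = const_mx 1.
Proof.
move=> jJ MF; apply/matrixP => o b; rewrite (ord1 o) -row_mul [LHS]mxE [RHS]mxE.
by rewrite -mulmx_col; have [_] := MF b; apply.
Qed.

(** A facet contains d affinely independent points; being combinations of the
    generators in the facet, they force d of those to be independent. *)
Lemma facet_basis V A j : (forall i j, (A^T *m V) j i <= 1) ->
  aff_rank (tight V A [set j]%SET) d ->
  exists f : 'I_d -> 'I_n,
    (forall a, j \in active V A (f a)) /\ colsub f V \in unitmx.
Proof.
move=> valid [[M [freeM MF]] _].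
have rM : \rank M = d.
  move/eqP: freeM; rewrite (@rank_homogenize_hyperplane _ _ _ _ (row j A^T)) //.
  by apply: tight_row MF; rewrite inE.
pose I := [set i | j \in active V A i]%SET.
pose W : 'M[R]_(#|I|, d) := \matrix_(a, b) V b (enum_val a).
have /row_fullP[L LW] : row_full W.
  rewrite /row_full eqn_leq rank_leq_col /= -{1}rM -mxrank_tr.
  apply: mxrankS; apply/row_subP => b.
  have [[l [l0 l1 bE]] _] := MF b; have Tb := MF b; rewrite bE in Tb.
  apply/submxP; exists (\row_a l (enum_val a) ord0); apply/rowP => c.
  have -> : (row b M^T) ord0 c = col b M c ord0 by rewrite !mxE.
  rewrite bE !mxE (bigID (mem I)) /= [X in _ + X]big1 ?addr0 => [|i iI].
    by rewrite big_enum_val; apply: eq_bigr => a _; rewrite !mxE mulrC.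
  have [->|li] := eqVneq (l i ord0) 0; first by rewrite mulr0.
  have /fintype.subsetP/(_ j) := tight_support valid l0 l1 Tb li.
  by move: iI; rewrite !inE eqxx => /negP iI /(_ isT) /iI.
have fullW : row_full W by apply/row_fullP; exists L.
exists (fun a => enum_val (fullrankfun fullW a)); split=> [a|].
  by have := enum_valP (fullrankfun fullW a); rewrite inE.
rewrite -unitmx_tr -row_full_unit /row_full.
have -> : (colsub (fun a => enum_val (fullrankfun fullW a)) V)^T =
          rowsub (fullrankfun fullW) W by apply/matrixP => a b; rewrite !mxE.
by rewrite mxrank_fullrowsub.
Qed.

(** A vertex is a tight set with one point, so no other generator lies on all
    inequalities active at it. If one facet contained another, both would span the
    same hyperplane. The negative of a generator lying on all facets would
    be a direction in which the polytope is unbounded. *)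
Lemma labeled_polytope_irredundant V A : conv V = polyhedron A ->
  is_labeled_polytope d (labeled_conv V A) -> irredundant V A.
Proof.
move=> VA [_ _ [/= injV vertV] [/= injF facF]].
have valid := closed_pair_valid VA.
have facet_face j : is_facet d (conv V) (tight V A [set j]%SET).
  by rewrite -facF -facet_tight; exists j.
have [C leC] := conv_bounded V.
have rec0 : forall u : 'cV[R]_d, (forall j, (A^T *m u) j ord0 <= 0) -> u = 0.
  by apply: (@recession0 _ C) => x b; rewrite -VA; exact: leC.
have basis j := facet_basis valid (facet_face j).2.
(* There is a facet: in dimension 0 it is the empty face, and otherwise the space
   is not bounded. *)
have [j0 _] : exists j : 'I_m, True.
  have [d0|d0] := posnP d.
    have : is_facet d (conv V) set0.
      split; first exists 0, 1; first split=> [x _|].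
      - by rewrite trmx0 mul0mx mxE ler01.
      - apply/seteqP; split=> x //= -[_]; rewrite trmx0 mul0mx mxE => /esym/eqP.
        by rewrite oner_eq0.
      - rewrite d0; split=> [|k M _ M0]; last first.
          by case: k M M0 => // k M /(_ ord0).
        exists 0; split=> [|[]//]; rewrite /aff_free -leqn0.
        by rewrite rank_leq_col.
    by rewrite -facF => -[j _ _]; exists j.
  case: (posnP m) => [m0|m0]; last by exists (Ordinal m0).
  have /matrixP/(_ (Ordinal d0) ord0) : const_mx 1 = 0 :> 'cV[R]_d.
    by apply: rec0 => j; move: (ltn_ord j); rewrite {2}m0.
  by rewrite !mxE => /eqP; rewrite oner_eq0.
split=> [i k ik|j k jk|i|//].
- apply: injV => /=.
  have : face (conv V) [set col i V] by rewrite -/(is_vertex _ _) -vertV; exists i.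
  move=> /(face_tight valid VA)[|J iJ]; first by exists (col i V).
  have /tight_col Ji : tight V A J (col i V) by rewrite -iJ.
  have : tight V A J (col k V) by apply/tight_col; exact: fintype.subset_trans ik.
  by rewrite -iJ => ->.
- apply: injF => /=.
  have [f [fj fU]] := basis j.
  have ejk : row j A^T = row k A^T.
    apply: (can_inj (mulmxK fU)); rewrite -!row_mul.
    apply/rowP => a; rewrite !mxE.
    have := fj a; have := jk _ (fj a).
    rewrite !inE ![(A^T *m V) _ _]mxE => /eqP kE /eqP jE.
    transitivity (1 : R); [rewrite -jE|rewrite -kE];
      by apply: eq_bigr => b _; rewrite !mxE.
  apply/seteqP; split=> x [Vx xE]; split=> //; rewrite -xE.
    have /rowP/(_ ord0) : row k A^T *m x = row j A^T *m x by rewrite ejk.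
    by rewrite -!row_mul !mxE.
  have /rowP/(_ ord0) : row j A^T *m x = row k A^T *m x by rewrite ejk.
  by rewrite -!row_mul !mxE.
- apply: contrapT => /forallNP all_i.
  have act j : (A^T *m col i V) j ord0 = 1.
    by have /negP := all_i j; rewrite negbK inE mulmx_col => /eqP.
  have /eqP : - col i V = 0.
    by apply: rec0 => j; rewrite mulmxN mxE act oppr_le0 ler01.
  rewrite oppr_eq0 => /eqP vi0; have := act j0.
  by rewrite vi0 mulmx0 mxE => /esym/eqP; rewrite oner_eq0.
Qed.

End Irredundant.

Section Realization.
Context {R : realType} {d n m : nat}.
Implicit Types (V : 'M[R]_(d, n)) (A : 'M[R]_(d, m)) (J K : {set 'I_m}).

Lemma aff_rank_inj (S : set 'cV[R]_d) r r' :
  aff_rank S r -> aff_rank S r' -> r = r'.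
Proof.
move=> [[M [freeM MS]] leS] [[M' [freeM' M'S]] leS'].
by apply/eqP; rewrite eqn_leq (leS' _ M) // (leS _ M').
Qed.

(** The polyhedron contains a small simplex spanned by the origin and
    multiples of the unit vectors. *)
Lemma polyhedron_full_dim A : aff_rank (polyhedron A) d.+1.
Proof.
split=> [|k M /eqP kE _]; last by rewrite -[leqLHS]kE rank_leq_row.
have [eps eps0 epsP] := exists_small (I := ('I_m * 'I_d)%type)
  (P := xpredT) (p := fun=> 1) (fun jb => A jb.2 jb.1) (fun _ _ => ltr01).
exists (row_mx (0 : 'cV_d) eps%:M); split=> [|i j].
  rewrite /aff_free -(@row_mx_const _ 1 1 d) -/(block_mx _ _ _ _).
  rewrite mxrank_unit // unitmxE det_ublock det_scalar det_mx11 mxE mul1r.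
  by rewrite unitfE expf_neq0 // gt_eqF.
rewrite mulmx_col (mul_mx_row A^T (0 : 'cV_d) eps%:M) mulmx0 mul_mx_scalar mxE.
case: splitP => b _; first by rewrite mxE ler01.
by rewrite mxE mxE ltW // (epsP (j, b)).
Qed.

Lemma tight_spanning_dim V A j : (forall i j, (A^T *m V) j i <= 1) ->
  (exists f : 'I_d -> 'I_n,
     (forall a, j \in active V A (f a)) /\ colsub f V \in unitmx) ->
  aff_rank (tight V A [set j]%SET) d.
Proof.
move=> valid [f [fj fU]].
have rowj k (M : 'M[R]_(d, k)) :
    (forall b, tight V A [set j]%SET (col b M)) -> row j A^T *m M = const_mx 1.
  by apply: tight_row; rewrite inE.
have tightf b : tight V A [set j]%SET (col b (colsub f V)).
  have -> : col b (colsub f V) = col (f b) V by apply/colP => c; rewrite !mxE.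
  by apply/tight_col; rewrite finset.sub1set.
split.
  exists (colsub f V); split=> //.
  by rewrite /aff_free (rank_homogenize_hyperplane (rowj _ _ tightf)) mxrank_unit.
move=> k M /eqP kE MF; rewrite -[leqLHS]kE.
by rewrite (rank_homogenize_hyperplane (rowj _ _ MF)) rank_leq_row.
Qed.

(** All faces are tight sets: the vertices are those of the inequalities active at
    a column of V, and the facets those of a single inequality. *)
Lemma irredundant_labeled_polytope V A : conv V = polyhedron A ->
  irredundant V A -> is_labeled_polytope d (labeled_conv V A).
Proof.
move=> VA irr; have valid := closed_pair_valid VA.
have [irrV irrF noall basis] := irr.
have dimF j := tight_spanning_dim valid (basis j).
have dimV : aff_rank (conv V) d.+1 by rewrite VA; exact: polyhedron_full_dim.
split=> //; first by exists n, V.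
- split=> [i k /= ik|].
    apply: irrV; apply/fintype.subsetP => j.
    by rewrite !inE -(mulmx_col _ _ i) -(mulmx_col _ _ k) ik.
  apply/seteqP; split=> [_ [i _ <-]|v face_v].
    by rewrite /is_vertex /= -(tight_active _ valid irrV); exact: tight_face.
  have [J vJ] := face_tightE VA irr face_v.
  have : tight V A J v by rewrite -vJ.
  move=> Tv; have [[l [l0 l1 vE]] _] := Tv; rewrite vE in Tv.
  have [i /(tight_support valid l0 l1 Tv)/tight_col] := weight_neq0 l1.
  by rewrite -vJ => <-; exists i.
- split=> [j k jk|].
    have {}jk : tight V A [set j]%SET = tight V A [set k]%SET.
      by rewrite -!facet_tight.
    apply: irrF => i ij.
    have /tight_col : [set j]%SET \subset active V A i by rewrite finset.sub1set.
    by rewrite jk => /tight_col; rewrite finset.sub1set.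
  apply/seteqP; split=> [_ [j _ <-]|F [face_F dim_F]].
    by rewrite facet_tight; split; [exact: tight_face|exact: dimF].
  have [J FJ] := face_tightE VA irr face_F.
  (* A face of dimension d - 1 lies on some inequality j; on a second one k it
     would determine the same hyperplane. *)
  have [J0|[j jJ]] := set_0Vmem J.
    have FV : F = conv V.
      by rewrite FJ J0; apply/seteqP; split=> x; [case|split=> // j; rewrite inE].
    have := aff_rank_inj dimV; rewrite -FV => /(_ _ dim_F)/eqP.
    by rewrite -addn1 -{2}[d]addn0 eqn_add2l.
  exists j => //; rewrite facet_tight FJ; congr tight.
  apply/setP => k; rewrite inE; apply/eqP/idP => [->//|kJ].
  have [[M [freeM MF]] _] := dim_F.
  have rowM i : i \in J -> row i A^T *m M = const_mx 1.
    by move=> iJ; apply: (tight_row (V := V) iJ) => b; rewrite -FJ.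
  have unitM : M \in unitmx.
    rewrite -row_free_unit /row_free -(rank_homogenize_hyperplane (rowM j jJ)).
    exact: freeM.
  have ejk : row j A^T = row k A^T.
    by apply: (can_inj (mulmxK unitM)); rewrite !rowM.
  apply/esym/irrF => i; rewrite !inE.
  suff -> : (A^T *m V) j i = (A^T *m V) k i by [].
  have : row j A^T *m V = row k A^T *m V by rewrite ejk.
  by rewrite -!row_mul => /rowP/(_ i); rewrite !mxE.
Qed.

(** A face goes to the tight set of the inequalities that are tight on it. *)
Lemma same_incidences_iso V A V' A' :
  conv V = polyhedron A -> irredundant V A ->
  conv V' = polyhedron A' -> irredundant V' A' ->
  active V A =1 active V' A' ->
  face_lattice_iso (labeled_conv V A) (labeled_conv V' A').
Proof.
move=> VA irr VA' irr' act.
have valid := closed_pair_valid VA; have valid' := closed_pair_valid VA'.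
have [irrV irrF _ _] := irr; have [irrV' _ _ _] := irr'.
have le_tight J K : tight V A J `<=` tight V A K <->
    tight V' A' J `<=` tight V' A' K.
  apply: (iff_trans (tight_subset valid J K)).
  apply: iff_sym; apply: (iff_trans (tight_subset valid' J K)).
  by split=> JK i; have := JK i; rewrite act.
have eq_tight J K : tight V A J = tight V A K -> tight V' A' J = tight V' A' K.
  by move=> JK; apply/seteqP; split; apply/le_tight; rewrite JK.
pose common (F : set 'cV[R]_d) : {set 'I_m} :=
  [set j | `[< forall x, F x -> (A^T *m x) j ord0 = 1 >]]%SET.
have tight_common J : tight V A (common (tight V A J)) = tight V A J.
  apply/seteqP; split=> x [Vx xJ]; split=> // j.
    by move=> jJ; apply: xJ; rewrite inE; apply/asboolP => y [_]; exact.
  by rewrite inE => /asboolP; apply.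
pose phi F := tight V' A' (common F).
have phi_tight J : phi (tight V A J) = tight V' A' J.
  by apply: eq_tight; exact: tight_common.
exists phi; split=> [|F G|i|j] /=.
- apply/seteqP; split=> [_ [F _ <-]|F' faceF']; first exact: tight_face.
  have [J ->] := face_tightE VA' irr' faceF'.
  by exists (tight V A J); [exact: tight_face|exact: phi_tight].
- move=> /(face_tightE VA irr)[J ->] /(face_tightE VA irr)[K ->].
  by rewrite !phi_tight; exact: iff_sym.
- rewrite -(tight_active _ valid irrV) phi_tight act.
  by rewrite (tight_active _ valid' irrV').
- have := facet_tight V A j; rewrite /= => ->; rewrite phi_tight.
  by have := facet_tight V' A' j; rewrite /= => ->.
Qed.

Lemma face_lattice_iso_trans e e' (P : @labeled_body R e n m)
    (Q : @labeled_body R e' n m) (Q' : @labeled_body R d n m) :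
  face_lattice_iso P Q -> face_lattice_iso Q Q' -> face_lattice_iso P Q'.
Proof.
move=> [phi [imP leP vP fP]] [psi [imQ leQ vQ fQ]].
have faceQ F : face (body P) F -> face (body Q) (phi F).
  by rewrite -imP => PF; exists F.
exists (psi \o phi); split=> [|F G PF PG|i|j] /=.
- by rewrite -imQ -imP image_comp.
- exact: (iff_trans (leQ _ _ (faceQ F PF) (faceQ G PG)) (leP F G PF PG)).
- by rewrite vP vQ.
- by rewrite fP fQ.
Qed.

Lemma realizes_incident e (P : @labeled_body R e n m) p V A :
  is_labeled_polytope p P -> face_lattice_iso P (labeled_conv V A) ->
  forall i j, incident P i j = (j \in active V A i).
Proof.
move=> [_ _ [_ vP] [_ fP]] [phi [_ lephi vphi fphi]] i j.
have faceV : face (body P) [set vertex P i].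
  by rewrite -/(is_vertex _ _) -vP; exists i.
have faceF : face (body P) (facet P j).
  by have : is_facet p (body P) (facet P j); [rewrite -fP; exists j|case].
have := lephi _ _ faceV faceF; rewrite vphi fphi facet_tight => iffP.
apply/asboolP/idP => [Pij|ij].
  have : tight V A [set j]%SET (col i V) by apply: iffP.2 => // x ->.
  by move=> /tight_col; rewrite finset.sub1set.
apply: (iffP.1 _ (vertex P i)) => // _ ->; apply/tight_col.
by rewrite finset.sub1set.
Qed.

End Realization.

(** * Stability of the incidences under perturbation *)

(** A point x is pushed away from a generator v lying on all inequalities tight
    at x, until a further inequality becomes tight. By induction on the number of
    inequalities that are not tight, the new point lies in conv V, and hence so
    does x, which lies between it and v. *)
Lemma polyhedron_sub_conv (R : realType) d n m (V : 'M[R]_(d, n))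
    (A : 'M[R]_(d, m)) :
  (forall u : 'cV[R]_d, (forall j, (A^T *m u) j ord0 <= 0) -> u = 0) ->
  (forall x, polyhedron A x -> exists i : 'I_n,
     forall j, (A^T *m x) j ord0 = 1 -> (A^T *m V) j i = 1) ->
  polyhedron A `<=` conv V.
Proof.
move=> rec0 tight_gen x.
have [k] := ubnP #|[set j | (A^T *m x) j ord0 != 1]%SET|.
elim: k x => // k IHk x; rewrite ltnS => le_k Ax.
have [i ix] := tight_gen x Ax; pose u := x - col i V.
have uE j : (A^T *m u) j ord0 = (A^T *m x) j ord0 - (A^T *m V) j i.
  by rewrite mulmxBr mxE [X in _ + X]mxE mulmx_col.
have [/existsP[j1 uj1]|] := boolP [exists j, 0 < (A^T *m u) j ord0]; last first.
  rewrite negb_exists => /forallP u_le0.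
  have /subr0_eq -> : u = 0 by apply: rec0 => j; rewrite leNgt.
  exact: conv_col.
pose t j := (1 - (A^T *m x) j ord0) / (A^T *m u) j ord0.
have [j0 uj0 min_j0] := @arg_minP _ _ _ j1 (fun j => 0 < (A^T *m u) j ord0) t uj1.
have t0 : 0 <= t j0 by rewrite divr_ge0 // ?subr_ge0 ?Ax // ltW.
pose z := x + t j0 *: u.
have zE j : (A^T *m z) j ord0 = (A^T *m x) j ord0 + t j0 * (A^T *m u) j ord0.
  by rewrite mulmxDr -scalemxAr mxE [X in _ + X]mxE.
have Az : polyhedron A z.
  move=> j; rewrite zE; have [uj|uj] := ltP 0 ((A^T *m u) j ord0).
    by rewrite -lerBrDl -ler_pdivlMr // min_j0.
  by rewrite (le_trans _ (Ax j)) // gerDl mulr_ge0_le0.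
have Vz : conv V z.
  apply: IHk Az; apply: leq_trans le_k; apply: proper_card.
  apply/properP; split.
    apply/fintype.subsetP => j; rewrite !inE zE; apply: contra => /eqP xj.
    by rewrite uE xj ix // subrr mulr0 addr0.
  exists j0; rewrite inE; last by rewrite negbK zE /t divfK ?(gt_eqF uj0) // subrKC.
  by apply: contraTneq uj0 => xj0; rewrite uE xj0 ix // subrr ltxx.
have t1 : 0 < 1 + t j0 by rewrite ltr_pwDl.
have -> : x = (1 + t j0)^-1 *: z + (1 - (1 + t j0)^-1) *: col i V.
  apply/matrixP => b o; rewrite !mxE; field.
  by rewrite gt_eqF.
apply: conv_convex Vz (conv_col _ _); first by rewrite invr_ge0 ltW.
by rewrite invf_le1 // lerDl.
Qed.

Section Perturbation.
Context {R : realType} {d n m : nat}.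

(** If the inequalities A are close to A0 on the vertices V0, their polyhedron
    is contained in a slightly enlarged copy of conv V0; hence inequalities
    with no common vertex of V0 cannot be tight simultaneously. *)
Lemma closed_pair_perturb (V0 : 'M[R]_(d, n)) (A0 : 'M[R]_(d, m)) :
  conv V0 = polyhedron A0 ->
  exists2 eta : R, 0 < eta &
    forall (V : 'M[R]_(d, n)) (A : 'M[R]_(d, m)),
      (forall i j, `|(A0^T *m V0) j i - (A^T *m V0) j i| < eta) ->
      (forall i j, (A^T *m V) j i <= 1) ->
      (forall i j, j \in active V0 A0 i -> (A^T *m V) j i = 1) ->
      conv V = polyhedron A.
Proof.
move=> VA0; have valid0 := closed_pair_valid VA0.
(* If no generator lies on all inequalities in J, their total slack is positive
   at each generator of V0. Changing A0 by eta and scaling by 1 - eta takes at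
   most 2 * eta * #|J| of it. *)
pose slack (Ji : {set 'I_m} * 'I_n) : R :=
  #|Ji.1|%:R - \sum_(j in Ji.1) (A0^T *m V0) j Ji.2.
have slack_gt0 (Ji : {set 'I_m} * 'I_n) :
    ~~ (Ji.1 \subset active V0 A0 Ji.2) -> 0 < slack Ji.
  move=> /fintype.subsetPn[j jJ]; rewrite inE => ji.
  by rewrite /slack subr_gt0; apply: (sum_lt_card (i := j)).
have [eta1 eta1_gt0 eta1P] :=
  exists_small (fun Ji : {set 'I_m} * 'I_n => #|Ji.1|%:R * 2) slack_gt0.
(* The bound 1 / 2 keeps 1 - eta positive. *)
pose eta := Num.min eta1 2^-1.
have eta0 : 0 < eta by rewrite lt_min eta1_gt0 invr_gt0 ltr0n.
have etaC : 0 < 1 - eta.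
  by rewrite subr_gt0 gt_min [X in _ || X]invf_lt1 ?ltr0n ?ltr1n ?orbT.
exists eta => // V A near_A valid AV.
apply/seteqP; split=> [x Vx j|].
  by move: Vx; apply: conv_le => i; exact: valid.
have scaled x : polyhedron A x -> conv V0 ((1 - eta) *: x).
  move=> Ax; rewrite VA0 => j1; rewrite leNgt; apply/negP => xj1.
  (* Otherwise y = x / M lies on the boundary of conv V0, where the inequality j
     has changed by less than eta. *)
  have [j _ max_j] := @arg_maxP _ _ _ j1 xpredT (fun j => (A0^T *m x) j ord0) isT.
  pose M := (A0^T *m x) j ord0.
  have M1 : 1 < (1 - eta) * M.
    apply: lt_le_trans xj1 _; rewrite -scalemxAr mxE ler_pM2l //; exact: max_j.
  have M0 : 0 < M by rewrite -(pmulr_rgt0 _ etaC) (lt_trans ltr01).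
  have V0y : conv V0 (M^-1 *: x).
    rewrite VA0 => k; rewrite -scalemxAr mxE -(mulVf (lt0r_neq0 M0)).
    rewrite ler_pM2l ?invr_gt0 //.
    exact: max_j.
  have [l [l0 l1 yE]] := V0y.
  have : 1 - eta <= (A^T *m (M^-1 *: x)) j ord0.
    have <- : (A0^T *m (M^-1 *: x)) j ord0 = 1.
      by rewrite -scalemxAr mxE mulVf // lt0r_neq0.
    rewrite yE !mulmx_comb lerBlDl -[X in X + _]mul1r -l1 mulr_suml -big_split /=.
    apply: ler_sum => i _; rewrite -mulrDr ler_wpM2l // -lerBlDr.
    exact: le_trans (ler_norm _) (ltW (near_A i j)).
  rewrite -scalemxAr mxE leNgt => /negP; apply.
  rewrite -(ltr_pM2l M0) mulrA mulfV ?lt0r_neq0 // mul1r mulrC.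
  exact: le_lt_trans (Ax j) M1.
apply: polyhedron_sub_conv => [|x Ax].
  have [C leC] := conv_bounded V0.
  apply: (@recession0 _ _ _ _ ((1 - eta)^-1 * C)) => x b /scaled/leC.
  move=> /(_ b); rewrite mxE normrM gtr0_norm // => le_C.
  by rewrite mulrC ler_pdivlMr // mulrC.
pose J := [set j | (A^T *m x) j ord0 == 1]%SET.
have [/existsP[i /fintype.subsetP Ji]|] := boolP [exists i, J \subset active V0 A0 i].
  by exists i => j xj; apply/AV/Ji; rewrite inE xj.
rewrite negb_exists => /forallP bad.
have lt_sum i : ((\sum_(j in J) row j A^T) *m V0) ord0 i < #|J|%:R * (1 - eta).
  rewrite sum_rows_mulmx.
  apply: (@le_lt_trans _ _ (\sum_(j in J) (A0^T *m V0) j i + #|J|%:R * eta)).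
    rewrite mulr_natl -sumr_const -big_split /=; apply: ler_sum => j _.
    rewrite -lerBlDl (le_trans (ler_norm _)) // distrC ltW //; exact: near_A.
  have := eta1P (J, i) (bad i); rewrite /slack /=.
  have : eta * (#|J|%:R * 2) <= eta1 * (#|J|%:R * 2).
    by rewrite ler_wpM2r ?mulr_ge0 // ge_min lexx.
  lra.
have := conv_lt lt_sum (scaled x Ax).
rewrite sum_rows_mulmx (eq_bigr (fun=> 1 - eta)) => [|j].
  by rewrite sumr_const mulr_natl ltxx.
by rewrite inE => /eqP xj; rewrite -scalemxAr mxE xj mulr1.
Qed.

End Perturbation.

Section Stability.
Context {R : realType} {d n m : nat}.
Implicit Types y : 'M[R]_(d, n + m).

Lemma Ck_lsubmx k b i : Ck_on k [set: 'M[R]_(d, n + m)]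
  (fun y : 'M[R]_(d, n + m) => lsubmx y b i : R).
Proof.
apply: (eq_Ck (f := fun y : 'M[R]_(d, n + m) => y b (lshift m i) : R)).
- exact: openT.
- by move=> y _; rewrite mxE.
- exact: Ck_coord.
Qed.

Lemma Ck_rsubmx_tr k j b : Ck_on k [set: 'M[R]_(d, n + m)]
  (fun y : 'M[R]_(d, n + m) => (rsubmx y)^T j b : R).
Proof.
apply: (eq_Ck (f := fun y : 'M[R]_(d, n + m) => y b (rshift n j) : R)).
- exact: openT.
- by move=> y _; rewrite !mxE.
- exact: Ck_coord.
Qed.

(** Once the incidence equations are imposed, what remains are open conditions:
    the strict inequalities, being close to y0, and the bases in the facets. *)
Lemma realization_near (y0 : 'M[R]_(d, n + m)) :
  conv (lsubmx y0) = polyhedron (rsubmx y0) ->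
  irredundant (lsubmx y0) (rsubmx y0) ->
  \forall y \near y0,
    (forall i j, j \in active (lsubmx y0) (rsubmx y0) i ->
       ((rsubmx y)^T *m lsubmx y) j i = 1) ->
    [/\ conv (lsubmx y) = polyhedron (rsubmx y),
        irredundant (lsubmx y) (rsubmx y) &
        active (lsubmx y0) (rsubmx y0) =1 active (lsubmx y) (rsubmx y)].
Proof.
set V0 := lsubmx y0; set A0 := rsubmx y0 => VA0 [irrV irrF noall basis].
have valid0 := closed_pair_valid VA0.
have [eta eta0 etaP] := closed_pair_perturb VA0.
have contC (h : 'M[R]_(d, n + m) -> R) : Ck_on 0 setT h ->
    h y @[y --> y0] --> h y0 by move=> Ch; exact: Ch.
have /fin_all_exists[f fP] := basis.
have near_lt : \forall y \near y0, forall i j,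
    j \notin active V0 A0 i -> ((rsubmx y)^T *m lsubmx y) j i < 1.
  apply: (@filter_forall _ 'I_n _ (nbhs y0) _) => i.
  apply: (@filter_forall _ 'I_m _ (nbhs y0) _) => j.
  have [_|ji] := boolP (j \in active V0 A0 i); first exact: nearW.
  have : ((rsubmx y0)^T *m lsubmx y0) j i < 1.
    by rewrite lt_neqAle valid0 andbT; move: ji; rewrite inE.
  move=> /(cvgr_lt _ (contC (fun y => ((rsubmx y)^T *m lsubmx y) j i) _)) lt1.
  apply: filterS (lt1 _) => //.
  apply: Ck_mulmx; [exact: openT|exact: Ck_rsubmx_tr|exact: Ck_lsubmx].
have near_eta : \forall y \near y0, forall i j,
    `|(A0^T *m V0) j i - ((rsubmx y)^T *m V0) j i| < eta.
  apply: (@filter_forall _ 'I_n _ (nbhs y0) _) => i.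
  apply: (@filter_forall _ 'I_m _ (nbhs y0) _) => j.
  have Ch : Ck_on 0 setT (fun y : 'M[R]_(d, n + m) =>
      ((rsubmx y)^T *m V0) j i : R).
    apply: Ck_mulmx; [exact: openT|exact: Ck_rsubmx_tr|].
    by move=> *; exact: Ck_cst.
  by have /cvgrPdist_lt := contC _ Ch; apply.
have near_unit : \forall y \near y0, forall j,
    \det (colsub (f j) (lsubmx y)) != 0.
  apply: (@filter_forall _ 'I_m _ (nbhs y0) _) => j.
  have : \det (colsub (f j) (lsubmx y0)) != 0.
    by rewrite -unitfE -unitmxE; have [] := fP j.
  have Ch : Ck_on 0 setT (fun y : 'M[R]_(d, n + m) =>
      \det (colsub (f j) (lsubmx y)) : R).
    apply: Ck_det; first exact: openT.
    move=> b a; apply: (eq_Ck (f := fun y => lsubmx y b (f j a) : R)).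
    - exact: openT.
    - by move=> y _; rewrite [RHS]mxE.
    - exact: Ck_lsubmx.
  exact: cvgr_neq0 (contC _ Ch).
apply: filterS3 near_lt near_eta near_unit => y lt1 eta_y unit_y AV.
set V := lsubmx y in lt1 AV *; set A := rsubmx y in lt1 AV *.
have act : active V0 A0 =1 active V A.
  move=> i; apply/setP => j; rewrite [RHS]inE.
  have [ji|ji] := boolP (j \in active V0 A0 i); first by rewrite AV ?eqxx.
  by rewrite (lt_eqF (lt1 i j ji)).
split=> //.
  apply: etaP => // i j.
  have [/AV ->//|ji] := boolP (j \in active V0 A0 i).
  exact/ltW/(lt1 i j).
split=> [i k|j k jk|i|j].
- by rewrite -!act; exact: irrV.
- by apply: irrF => i; have := jk i; rewrite -!act.
- by have [j] := noall i; rewrite act; exists j.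
- exists (f j); split=> [a|]; first by rewrite -act; have [] := fP j.
  by rewrite unitmxE unitfE.
Qed.

End Stability.

(** * Linear independence of neighbouring nodes *)

(** Of at most three numbers, at most one is negative or at most one is
    positive. *)
Lemma lone_sign (R : realType) k (l : 'I_k -> R) : (k <= 3)%N ->
  exists s : R, s != 0 /\
    ((forall a, 0 <= s * l a) \/ exists a, forall b, b != a -> 0 <= s * l b).
Proof.
move=> k3; have [|gt1] := leqP #|[set a | l a < 0]%SET| 1.
  rewrite leq_eqVlt ltnS leqn0 => /orP[/cards1P[a aE]|/eqP/cards0_eq negE].
    exists 1; rewrite oner_eq0; split=> //; right; exists a => b ba.
    rewrite mul1r leNgt; apply: contra ba => lb.
    by rewrite -finset.in_set1 -aE inE.
  exists 1; rewrite oner_eq0; split=> //; left => a.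
  rewrite mul1r leNgt; apply/negP => la.
  by have := finset.in_set0 a; rewrite -negE inE la.
have := cardsC [set a | l a < 0]%SET; rewrite card_ord => cardE.
have : (#|~: [set a | (l a < 0)%R]%SET| <= 1)%N.
  by rewrite -(leq_add2l 2) (leq_trans _ k3) // -[leqRHS]cardE leq_add2r.
rewrite leq_eqVlt ltnS leqn0 => /orP[/cards1P[a aE]|/eqP/cards0_eq negE].
  exists (-1); rewrite oppr_eq0 oner_eq0; split=> //; right; exists a => b ba.
  rewrite mulN1r oppr_ge0 leNgt; apply: contra ba => lb.
  by rewrite -finset.in_set1 -aE !inE -leNgt ltW.
exists (-1); rewrite oppr_eq0 oner_eq0; split=> //; left => a.
rewrite mulN1r oppr_ge0 leNgt; apply/negP => la.
by have := finset.in_set0 a; rewrite -negE !inE -leNgt ltW.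
Qed.

(** An affine dependence of at most three points expresses one of them as a convex
    combination of the others. This is impossible if each point a is the only one
    to maximize some functional, whose value at b is g a b. *)
Lemma exposed_free (R : realType) k (l : 'I_k -> R) (g : 'I_k -> 'I_k -> R) :
  (k <= 3)%N -> \sum_a l a = 0 -> (forall a, \sum_b l b * g a b = 0) ->
  (forall a b, b != a -> g a b < g a a) -> forall a, l a = 0.
Proof.
move=> k3 l0 lg ltg.
have pos_eq0 s a : s != 0 -> (forall b, b != a -> 0 <= s * l b) ->
    forall b, l b = 0.
  move=> s0 sl; have lb0 b : b != a -> l b = 0.
    have /eqP : \sum_(b | b != a) s * l b * (g a a - g a b) = 0.
      transitivity (\sum_b s * l b * (g a a - g a b)).
        by rewrite [RHS](bigD1 a) //= subrr mulr0 add0r.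
      under eq_bigr do rewrite -mulrA mulrBr.
      by rewrite -mulr_sumr sumrB -mulr_suml l0 lg mul0r subrr mulr0.
    rewrite psumr_eq0 => [/allP/(_ b (mem_index_enum b))/implyP sl0 ba|c ca].
      have := sl0 ba; rewrite !mulf_eq0 (negbTE s0) /= => /orP[/eqP //|].
      by rewrite subr_eq0 gt_eqF // ltg.
    by rewrite mulr_ge0 ?sl // subr_ge0 ltW // ltg.
  move=> b; have [ba|] := eqVneq b a; last exact: lb0.
  by move: l0; rewrite ba (bigD1 a) //= big1 ?addr0.
have [s [s0 [sl a|[a sl]]]] := lone_sign l k3; last exact: pos_eq0 sl.
exact: (pos_eq0 s a s0 (fun b _ => sl b)).
Qed.

(** The rows of W lie on a hyperplane that avoids the origin, and no row is
    redundant: the sum of the inequalities tight at a row is a functional that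
    this row alone maximizes. *)
Lemma exposed_row_free (R : realType) k d n (W : 'M[R]_(k, d))
    (X : 'M[R]_(d, n)) c :
  (k <= 3)%N -> (forall a i, (W *m X) a i <= 1) ->
  (forall a, (W *m X) a c = 1) ->
  (forall a b, (forall i, (W *m X) a i = 1 -> (W *m X) b i = 1) -> a = b) ->
  row_free W.
Proof.
move=> k3 le1 eq1 irr; apply: inj_row_free => l lW.
have lWX i : \sum_a l ord0 a * (W *m X) a i = 0.
  have : (l *m W *m X) ord0 i = 0 by rewrite lW mul0mx mxE.
  by rewrite -mulmxA mxE.
pose g a b := \sum_(i | (W *m X) a i == 1) (W *m X) b i.
apply/rowP => a; rewrite mxE; move: a; apply: (exposed_free (g := g)) => //.
- by rewrite -[RHS](lWX c); apply: eq_bigr => a _; rewrite eq1 mulr1.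
- move=> a; rewrite /g; under eq_bigr do rewrite mulr_sumr.
  by rewrite exchange_big big1.
- move=> a b ba; rewrite {2}/g (eq_bigr (fun=> 1)) => [|i /eqP //].
  have [i ai bi] : exists2 i, (W *m X) a i = 1 & (W *m X) b i != 1.
    apply: contrapT => nex; move/eqP: ba; apply; apply/esym/irr => i ai.
    by apply/eqP/negPn/negP => bi; apply: nex; exists i.
  rewrite sumr_const /g; apply: (sum_lt_card (i := i)) => //.
  exact/eqP.
Qed.

(** If d vectors span the space, they are independent, and so are any of
    them. *)
Lemma spanning_row_free (F : fieldType) (T : finType) d (N : {set T})
    (w : T -> 'rV[F]_d) k (h : 'I_k -> T) :
  #|N| = d -> (forall u : 'cV_d, (forall t, t \in N -> w t *m u = 0) -> u = 0) ->
  injective h -> (forall a, h a \in N) -> row_free (\matrix_a w (h a)).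
Proof.
move=> dE; subst d; move=> span injh hN.
pose M := \matrix_(a < #|N|) w (enum_val a).
have unitM : M \in unitmx.
  rewrite -unitmx_tr -row_free_unit; apply: inj_row_free => u uM.
  apply: trmx_inj; rewrite trmx0; apply: span => t tN.
  have : row (enum_rank_in tN t) (M *m u^T) = 0.
    by rewrite -[M]trmxK -trmx_mul uM trmx0 row0.
  by rewrite row_mul rowK enum_rankK_in.
pose r a := enum_rank_in (hN a) (h a).
have injr : injective r.
  by move=> a b /(congr1 enum_val); rewrite !enum_rankK_in // => /injh.
apply/row_freeP; exists (invmx M *m (rowsub r 1%:M)^T).
have -> : \matrix_a w (h a) = rowsub r M.
  by apply/row_matrixP => a; rewrite rowK row_rowsub rowK enum_rankK_in.
rewrite mulmxA mul_rowsub_mx mulmxV //; apply/matrixP => a b.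
rewrite !mxE (bigD1 (r b)) //= big1 ?addr0 => [|c cb].
  by rewrite !mxE eqxx mulr1 (inj_eq injr).
by rewrite !mxE [r b == c]eq_sym (negbTE cb) mulr0.
Qed.

Section Nodes.
Context {R : realType} {d n m : nat}.
Local Notation node := ('I_n + 'I_m)%type.

Definition node_vec (y : 'M[R]_(d, n + m)) (t : node) : 'rV[R]_d :=
  \row_b y b (unsplit t).

Variables (y : 'M[R]_(d, n + m)) (G : rel node).
Let V := lsubmx y.
Let A := rsubmx y.
Hypothesis closed_pair : conv V = polyhedron A.
Hypothesis irr : irredundant V A.
Hypothesis Gll : forall i i', G (inl i) (inl i') = false.
Hypothesis Grr : forall j j', G (inr j) (inr j') = false.
Hypothesis Glr : forall i j, G (inl i) (inr j) = (j \in active V A i).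
Hypothesis Grl : forall i j, G (inr j) (inl i) = (j \in active V A i).

(** The normals of the facets at a vertex v lie on the hyperplane of vectors with
    scalar product 1 with v; dually for the vertices of a facet. *)
Lemma three_neighbours_free x k (h : 'I_k -> node) : (k <= 3)%N ->
  injective h -> (forall a, G x (h a)) ->
  row_free (\matrix_a node_vec y (h a)).
Proof.
have [irrV irrF _ _] := irr; have valid := closed_pair_valid closed_pair.
move=> k3 injh Gh; set W := \matrix_a _; case: x Gh => [i|j] Gh.
  have /fin_all_exists[h' hE] a : exists j, h a = inr j.
    by have := Gh a; case: (h a) => [i'|j]; [rewrite Gll|exists j].
  have WV a i' : (W *m V) a i' = (A^T *m V) (h' a) i'.
    by rewrite !mxE; apply: eq_bigr => b _; rewrite !mxE hE.
  apply: (@exposed_row_free _ _ _ _ W V i) => // [a i'|a|a b ab].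
  - by rewrite WV.
  - by rewrite WV; have := Gh a; rewrite hE Glr inE => /eqP.
  - apply: injh; rewrite !hE; congr inr; apply: irrF => i'.
    by rewrite !inE -!WV => /eqP/ab ->.
have /fin_all_exists[h' hE] a : exists i, h a = inl i.
  by have := Gh a; case: (h a) => [i|j']; [exists i|rewrite Grr].
have WA a j' : (W *m A) a j' = (A^T *m V) j' (h' a).
  by rewrite !mxE; apply: eq_bigr => b _; rewrite !mxE hE mulrC.
apply: (@exposed_row_free _ _ _ _ W A j) => // [a j'|a|a b ab].
- by rewrite WA.
- by rewrite WA; have := Gh a; rewrite hE Grl inE => /eqP.
- apply: injh; rewrite !hE; congr inl; apply: irrV; apply/fintype.subsetP => j'.
  by rewrite !inE -!WA => /eqP/ab ->.
Qed.

(** At a vertex, a direction orthogonal to the normals of all facets through it would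
    lead along the intersection of these facets, which is the vertex alone. For a
    facet, its vertices contain a basis. *)
Lemma neighbours_span x (u : 'cV[R]_d) :
  (forall t, G x t -> node_vec y t *m u = 0) -> u = 0.
Proof.
have [irrV _ _ basis] := irr; have valid := closed_pair_valid closed_pair.
case: x => [i|j] Gu; last first.
  have [f [fj fU]] := basis j.
  apply: trmx_inj; rewrite trmx0; apply: (can_inj (mulmxK fU)).
  rewrite mul0mx; apply/rowP => a; rewrite [RHS]mxE.
  have /matrixP/(_ ord0 ord0) := Gu (inl (f a)) (etrans (Grl _ _) (fj a)).
  rewrite !mxE => eq0; rewrite -[RHS]eq0.
  by apply: eq_bigr => b _; rewrite !mxE mulrC.
have uJ j : j \in active V A i -> (A^T *m u) j ord0 = 0.
  move=> ji; have /matrixP/(_ ord0 ord0) := Gu (inr j) (etrans (Glr _ _) ji).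
  rewrite !mxE => eq0; rewrite -[RHS]eq0.
  by apply: eq_bigr => b _; rewrite !mxE.
have slack_gt0 j : j \notin active V A i -> 0 < 1 - (A^T *m V) j i.
  by rewrite inE => ji; rewrite subr_gt0 lt_neqAle ji valid.
have [eps eps0 epsP] := exists_small (fun j => (A^T *m u) j ord0) slack_gt0.
have stepE j : (A^T *m (col i V + eps *: u)) j ord0 =
    (A^T *m V) j i + eps * (A^T *m u) j ord0.
  by rewrite mulmxDr -scalemxAr mxE mulmx_col [X in _ + X]mxE.
have : tight V A (active V A i) (col i V + eps *: u).
  split=> [|j ji].
    rewrite closed_pair => j; rewrite stepE.
    have [ji|/epsP] := boolP (j \in active V A i).
      by rewrite uJ // mulr0 addr0 valid.
    by rewrite ltrBrDl => /ltW.
  by rewrite stepE uJ // mulr0 addr0; move: ji; rewrite inE => /eqP.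
rewrite (tight_active _ valid irrV) => /eqP; rewrite eq_sym -subr_eq0 opprD.
rewrite addrA subrr sub0r oppr_eq0 scaler_eq0 gt_eqF //= => /eqP //.
Qed.

End Nodes.

(** * Counting incidences *)

Lemma card_set_sum (T : finType) (p : pred T) :
  #|[set x | p x]%SET| = (\sum_x p x)%N.
Proof.
by rewrite -sum1dep_card big_mkcond; apply: eq_bigr => x _; case: (p x).
Qed.

Section Counting.
Context {R : realType} {e n m : nat} (P : @labeled_body R e n m).
Local Notation node := ('I_n + 'I_m)%type.
Local Notation G := (incidence_graph P).

Lemma incidence_graph_sym : symmetric G.
Proof. by case=> [i|j] [i'|j']. Qed.

Lemma incidence_graph_irr : irreflexive G.
Proof. by case. Qed.

Definition later_nodes (s : seq node) (x : node) : {set node} :=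
  [set y | G x y && (index x s < index y s)%N]%SET.

(** Every edge is counted at the endpoint that comes first. *)
Lemma sum_later_nodes s : uniq s -> (forall x, x \in s) ->
  (\sum_x #|later_nodes s x|)%N = num_incidences P.
Proof.
move=> us ins; rewrite big_sumType /= /num_incidences card_set_sum.
rewrite -(pair_big xpredT xpredT (fun i j => incident P i j : nat)) /=.
under eq_bigr do rewrite card_set_sum big_sumType /= big1 // add0n.
under [X in (_ + X)%N]eq_bigr do
  rewrite card_set_sum big_sumType /= [X in (_ + X)%N]big1 // addn0.
rewrite [X in (_ + X)%N]exchange_big -big_split /=; apply: eq_bigr => i _.
rewrite -big_split; apply: eq_bigr => j _ /=; case: (incident P i j) => //=.
have := @index_inj _ (inl i) _ _ _ (ins (inl i)) (ins (inr j)).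
by case: ltngtP => // eq_ij /(_ eq_ij).
Qed.

(** For d at most 2, any d + 1 vertices are at most three exposed points, hence
    affinely independent, and do not fit in a facet. *)
Lemma facet_few_vertices d j : is_labeled_polytope d P -> (d <= 2)%N ->
  (#|[set i | incident P i j]%SET| <= d)%N.
Proof.
move=> [_ _ [injv vP] [_ fP]] d2; rewrite leqNgt; apply/negP => lt_d.
pose h (a : 'I_d.+1) := enum_val (widen_ord lt_d a).
have injh : injective h by move=> a b /enum_val_inj/(congr1 val)/= /val_inj.
have hj a : facet P j (vertex P (h a)).
  by apply/asboolP; have := enum_valP (widen_ord lt_d a); rewrite inE.
have [_ [_ le_dim]] : is_facet d (body P) (facet P j).
  by rewrite -fP; exists j.
pose M : 'M[R]_(e, d.+1) := \matrix_(b, a) vertex P (h a) b ord0.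
have colM a : col a M = vertex P (h a).
  by apply/matrixP => b o; rewrite (ord1 o) !mxE.
suff freeM : aff_free M.
  have Mj a : facet P j (col a M) by rewrite colM.
  by have := le_dim _ M freeM Mj; rewrite ltnn.
have vbody i : body P (vertex P i).
  have : face (body P) [set vertex P i] by rewrite -/(is_vertex _ _) -vP; exists i.
  by move=> [c [b [_ E]]]; have : [set vertex P i] (vertex P i) by []; rewrite E => -[].
have /fin_all_exists[c cP] (a : 'I_d.+1) : exists c : 'cV[R]_e, forall b, b != a ->
    (c^T *m vertex P (h b)) ord0 ord0 < (c^T *m vertex P (h a)) ord0 ord0.
  have : face (body P) [set vertex P (h a)].
    by rewrite -/(is_vertex _ _) -vP; exists (h a).
  move=> [c [t [ct E]]]; exists c => b ba.
  have : [set vertex P (h a)] (vertex P (h a)) by [].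
  rewrite E => -[_ ->]; rewrite lt_neqAle ct // andbT; apply: contra ba => /eqP cb.
  have : [set vertex P (h a)] (vertex P (h b)) by rewrite E; split.
  by move=> /injv/injh ->.
rewrite /aff_free -mxrank_tr; apply: inj_row_free => l.
rewrite tr_col_mx mul_mx_row -[0]row_mx0 => /eq_row_mx[l1 lM].
have l0 : \sum_a l ord0 a = 0.
  have /matrixP/(_ ord0 ord0) := l1; rewrite !mxE => eq0.
  by rewrite -[RHS]eq0; apply: eq_bigr => a _; rewrite !mxE mulr1.
apply/rowP => a; rewrite mxE; move: a.
apply: (exposed_free (g := fun a b => ((c a)^T *m vertex P (h b)) ord0 ord0)) => //.
move=> a; have : ((c a)^T *m (l *m M^T)^T) ord0 ord0 = 0.
  by rewrite lM trmx0 mulmx0 mxE.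
rewrite trmx_mul trmxK mulmx_comb => eq0; rewrite -[RHS]eq0.
by apply: eq_bigr => b _; rewrite -colM mulmx_col [l^T _ _]mxE.
Qed.

End Counting.

(** * The centered realization space *)

(** Putting the nodes of degree d first does not create later neighbours for
    the remaining nodes. *)
Lemma degree_first_order (T : finType) (G : rel T) k d :
  degenerate k (remove_degree G d) ->
  exists s : seq T, [/\ uniq s, forall x, x \in s &
    forall x, degree G x != d ->
      (#|[set y | G x y && (index x s < index y s)%N]%SET| <= k)%N].
Proof.
move=> [s1 [us1 ins1 s1k]].
pose s0 := [seq x <- enum T | degree G x == d].
have mem_s0 x : (x \in s0) = (degree G x == d).
  by rewrite mem_filter mem_enum andbT.
have mem_s1 x : (x \in map val s1) = (degree G x != d).
  apply/mapP/idP => [[x' _ ->]|dx]; first exact: (svalP x').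
  by exists (exist _ x dx).
exists (s0 ++ map val s1); split=> [|x|x dx].
- rewrite cat_uniq filter_uniq ?enum_uniq //= (map_inj_uniq val_inj) us1 andbT.
  by apply/hasPn => x; rewrite mem_s0 mem_s1.
- by rewrite mem_cat mem_s0 mem_s1 orbN.
have index_s1 x' : index (val x') (s0 ++ map val s1) = (size s0 + index x' s1)%N.
  by rewrite index_cat mem_s0 (negbTE (svalP x')) (index_map val_inj).
pose x' : {x | degree G x != d} := exist _ x dx.
apply: leq_trans (s1k x').
apply: leq_trans (leq_imset_card val _); apply/subset_leq_card/fintype.subsetP => y.
rewrite inE => /andP[xy]; rewrite -[x]/(val x') index_s1 => lt_y.
have dy : degree G y != d.
  rewrite -mem_s0; apply/negP => ys0; move: lt_y.
  by rewrite index_cat ys0 ltnNge (leq_trans (index_size _ _)) // leq_addr.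
pose y' : {x | degree G x != d} := exist _ y dy.
move: lt_y; rewrite -[y]/(val y') index_s1 ltn_add2l => lt_y.
by apply/imsetP; exists y' => //; rewrite inE lt_y andbT.
Qed.

Theorem theorem4p4 (R : realType) (d e n m : nat)
    (P : @labeled_body R e n m) (HP : is_labeled_polytope d P)
    (Hdeg : degenerate 3 (remove_degree (incidence_graph P) d)) :
  exists2 k : nat, k%:Z = natural_guess d P &
    embedded_submanifold (centered_realization_space d P) k.
Proof.
set G := incidence_graph P in Hdeg *.
have [s [us ins s3]] := degree_first_order Hdeg.
have sumE := sum_later_nodes P us ins.
have Gsym : symmetric G := @incidence_graph_sym _ _ _ _ P.
have le_degree x : (#|later_nodes P s x| <= degree G x)%N.
  apply/subset_leq_card/fintype.subsetP => y.
  by rewrite !inE => /andP[].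
(* The dimension must be a natural number before any realization is at hand. For
   d at least 3 the order gives every node at most d later neighbours; for
   smaller d the edges are counted at the facets. *)
have le_dim : (num_incidences P <= d * (n + m))%N.
  have [d2|d3] := leqP d 2.
    have -> : num_incidences P = (\sum_j #|[set i | incident P i j]%SET|)%N.
      rewrite /num_incidences card_set_sum.
      rewrite -(pair_big xpredT xpredT (fun i j => incident P i j : nat)) /=.
      by rewrite exchange_big; apply: eq_bigr => j _; rewrite card_set_sum.
    apply: (@leq_trans (\sum_(j < m) d)%N).
      by apply: leq_sum => j _; exact: facet_few_vertices.
    by rewrite sum_nat_const card_ord mulnC leq_mul2l leq_addl orbT.
  rewrite -sumE mulnC.
  have -> : ((n + m) * d = \sum_(x : 'I_n + 'I_m) d)%N.
    by rewrite sum_nat_const card_sum !card_ord.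
  apply: leq_sum => x _; have [<-|dx] := eqVneq (degree G x) d.
    exact: le_degree.
  exact: leq_trans (s3 x dx) _.
exists (d * (n + m) - num_incidences P)%N; first by rewrite /natural_guess subzn.
split; first exact: leq_subr.
move=> y0 [VA0 [lab0 iso0]].
have irr0 := labeled_polytope_irredundant VA0 lab0.
have act0 := realizes_incident HP iso0.
pose E : rel 'I_(n + m) := fun i j => G (fintype.split i) (fintype.split j).
pose t : seq 'I_(n + m) := map unsplit s.
have unsplit_inj := can_inj (@unsplitK n m).
have Esym : symmetric E by move=> i j; exact: Gsym.
have Eirr : irreflexive E by move=> i; exact: incidence_graph_irr.
have ut : uniq t by rewrite (map_inj_uniq unsplit_inj).
have int i : i \in t by rewrite -[i]splitK map_f.
have mem_laterE i x : (unsplit x \in later E t (unsplit i)) =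
    (x \in later_nodes P s i).
  by rewrite mem_later inE /E !unsplitK !(index_map unsplit_inj).
have uniq_later i : uniq (later E t i) by rewrite filter_uniq ?enum_uniq.
have size_later x : size (later E t (unsplit x)) = #|later_nodes P s x|.
  rewrite -(card_uniqP (uniq_later _)) -(fintype.card_image unsplit_inj).
  apply: eq_card => i; rewrite -[i]splitK mem_laterE.
  by rewrite (fintype.mem_image unsplit_inj).
have -> : num_incidences P = (\sum_i size (later E t i))%N.
  rewrite -sumE [RHS](reindex unsplit) /=; last first.
    by exists fintype.split => i _; [exact: unsplitK|exact: splitK].
  by apply: eq_bigr => x _; rewrite size_later.
pose O := [set y : 'M[R]_(d, n + m) |
    (forall i j, j \in active (lsubmx y0) (rsubmx y0) i ->
       ((rsubmx y)^T *m lsubmx y) j i = 1) ->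
    [/\ conv (lsubmx y) = polyhedron (rsubmx y),
        irredundant (lsubmx y) (rsubmx y) &
        active (lsubmx y0) (rsubmx y0) =1 active (lsubmx y) (rsubmx y)]].
have nearO : nbhs y0 O := realization_near VA0 irr0.
have productsE (y : 'M[R]_(d, n + m)) : unit_products E y <->
    (forall i j, incident P i j -> ((rsubmx y)^T *m lsubmx y) j i = 1).
  have dotE i j : ((rsubmx y)^T *m lsubmx y) j i =
      \sum_b y b (lshift m i) * y b (rshift n j).
    by rewrite mxE; apply: eq_bigr => b _; rewrite !mxE mulrC.
  split=> [Ey i j ij|Ey a b].
    rewrite dotE; apply: Ey.
    by rewrite /E -/(unsplit (inl i)) -/(unsplit (inr j)) !unsplitK.
  rewrite /E -{2}[a]splitK -{2}[b]splitK.
  case: (fintype.split a) (fintype.split b) => [i|j] [i'|j'] //= ij.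
    by rewrite -dotE Ey.
  by under eq_bigr do rewrite mulrC; rewrite -dotE Ey.
have [Gll Grr] : (forall i i', G (inl i) (inl i') = false) /\
    (forall j j', G (inr j) (inr j') = false) by [].
apply: (@unit_products_chart R d (n + m) E t Esym Eirr ut int y0 O^°) => //.
- exact: open_interior.
- move=> y /interior_subset Oy; apply: (iff_trans _ (iff_sym (productsE y))); split.
    move=> [VA [lab iso]] i j; rewrite (realizes_incident HP iso) inE => /eqP //.
  move=> Ey; have [i j|VA irr act] := Oy; first by rewrite -act0 => /Ey.
  split=> //; split; first exact: irredundant_labeled_polytope.
  apply: face_lattice_iso_trans iso0 _.
  exact: same_incidences_iso.
- move=> i; have [x ->] : exists x, i = unsplit x.
    by exists (fintype.split i); rewrite splitK.
  pose h (a : 'I_(size (later E t (unsplit x)))) :=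
    fintype.split (nth (unsplit x) (later E t (unsplit x)) a).
  have injh : injective h.
    move=> a b /(can_inj splitK)/eqP; rewrite nth_uniq // => /eqP/val_inj //.
  have hG a : h a \in later_nodes P s x.
    by rewrite -mem_laterE splitK mem_nth.
  have -> : later_mx E t (unsplit x) y0 = \matrix_a node_vec y0 (h a).
    by apply/matrixP => a b; rewrite !mxE splitK; congr (y0 b _).
  have nbr a : G x (h a) by have := hG a; rewrite inE => /andP[].
  have [dx|dx] := eqVneq (degree G x) d.
    apply: (spanning_row_free dx) => // [u Gu|a]; last by rewrite inE.
    apply: (@neighbours_span _ _ _ _ y0 G VA0 irr0 act0 _ x) => // z xz.
    by apply: Gu; rewrite inE.
  apply: (@three_neighbours_free _ _ _ _ y0 G VA0 irr0 Gll Grr act0 _ x) => //.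
  by rewrite size_later; exact: s3.
Qed.
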